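(* Consider a weighted projective space $\mathbb{P}(q_0,q_1,\ldots,q_n)$ with $q_0 = 1$ and $\operatorname{lcm}(q_i,q_j,q_k) = d$ for all pairwise distinct $i,j,k$, where $d := \operatorname{lcm}(q_1,\ldots,q_n)$. Let $a_i := d/q_i$ and $b_{ij} := \operatorname{lcm}(q_i,q_j)/q_i$ for all $i,j \in \{0,1,\ldots,n\}$. Then the following are injective morphisms: \[\varphi_1 \colon \mathbb{P}(q_0,\ldots,q_n) \to \mathbb{P}^{n+1},\quad [x_0:\ldots:x_n] \mapsto [x_0^d : x_0^{d-q_1}x_1 : x_1^{a_1} + x_0^{d-q_2}x_2 : x_2^{a_2}+x_0^{d-q_3}x_3 : \ldots : x_{n-1}^{a_{n-1}} + x_0^{d-q_n}x_n : x_n^{a_n}],\] and, for each $k \geq 2$, \[\varphi_k \colon \mathbb{P}(q_0,\ldots,q_n) \to \mathbb{P}^{2n},\quad [x_0:\ldots:x_n] \mapsto \Big[\sum_{\substack{i+j=\ell\\ i \leq j}} x_i^{k a_i - b_{ij}} x_j^{b_{ji}} \;\Big|\; \ell = 0,1,\ldots,2n\Big].\] In particular, \[\operatorname{injdim}(\mathbb{P}(q_0,\ldots,q_n),\mathcal{O}(kd)) = \begin{cases} \infty & \text{if } k \leq 0,\\ n & \text{if } k=1 \text{ and } q_1 = \ldots = q_n,\\ n+1 & \text{if } k = 1 \text{ and } q_1,\ldots,q_n \text{ not all equal},\\ 2n & \text{if } k \geq 2.\end{cases}\]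
   Context: Over $\mathbb{C}$. $\mathbb{P}(q_0,\ldots,q_n) = \operatorname{Proj}\mathbb{C}[x_0,\ldots,x_n]$ with $\deg x_i = q_i$, and $\mathcal{O}(m)$ is its twisting sheaf of degree $m$ (global sections: weighted homogeneous polynomials of degree $m$). For a line bundle $\mathscr{L}$ on a projective variety $X$ and a nonzero subspace $V \subseteq H^0(X,\mathscr{L})$, $\varphi_V \colon X \dashrightarrow \mathbb{P}(V^* )$ is the rational map given by the sections in $V$; $\operatorname{injdim}(X,\mathscr{L}) := \inf\{\dim V - 1 : \varphi_V \text{ is an injective morphism}\}$, with $\inf\emptyset=\infty$. *)

(* Defs.v *)
From mathcomp Require Import all_boot all_algebra.
From mathcomp Require Import boolp reals complex mpoly.

Set Implicit Arguments.
Unset Strict Implicit.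
Unset Printing Implicit Defensive.

Import GRing.Theory Num.Theory.
Local Open Scope ring_scope.

Section WPS.
Variables (R : realType) (n : nat).
Local Notation C := (R[i]).
Local Notation poly := {mpoly C[n.+1]}.

Variable q : 'I_n.+1 -> nat.

Definition wdeg (mo : 'X_{1..n.+1}) : nat := (\sum_(i < n.+1) q i * mo i)%N.

(* weighted homogeneous polynomial of degree m (m : int); these form
   H^0(P(q), O(m)). The zero polynomial is homogeneous of every degree. *)
Definition whomog (m : int) (p : poly) : Prop :=
  forall mo, mo \in msupp p -> (wdeg mo)%:Z = m.

(* points of P(q) are represented by nonzero vectors of C^{n+1} *)
Definition nonzero_pt (x : 'I_n.+1 -> C) : Prop := exists i, x i != 0.

(* x and y represent the same point of P(q): y = lambda . x *)
Definition wequiv (x y : 'I_n.+1 -> C) : Prop :=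
  exists2 l : C, l != 0 & forall i, y i = l ^+ q i * x i.

(* the rational map given by sections f_0..f_N of O(m) is an injective
   morphism to P^N: the f_j lie in H^0(O(m)), have no common zero on
   P(q) (morphism), and the induced map on points is injective. *)
Definition inj_morphism (m : int) (N : nat) (f : 'I_N.+1 -> poly) : Prop :=
  [/\ forall j, whomog m (f j),
      forall x, nonzero_pt x -> exists j, (f j).@[x] != 0 &
      forall x y, nonzero_pt x -> nonzero_pt y ->
        (exists2 mu : C, mu != 0 & forall j, (f j).@[y] = mu * (f j).@[x]) ->
        wequiv x y].

Definition lin_indep (N : nat) (f : 'I_N.+1 -> poly) : Prop :=
  forall c : 'I_N.+1 -> C, \sum_(j < N.+1) c j *: f j = 0 -> forall j, c j = 0.

(* dim V - 1 = N is attained: V spanned by a basis f_0..f_N *)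
Definition injdim_attained (m : int) (N : nat) : Prop :=
  exists f : 'I_N.+1 -> poly, lin_indep f /\ inj_morphism m f.

(* injdim(P(q), O(m)) : None stands for +infinity (inf of the empty set) *)
Definition injdim (m : int) : option nat :=
  match pselect (exists N, injdim_attained m N) with
  | left h => Some (ex_minn (P := fun N => `[< injdim_attained m N >])
                      (let: ex_intro N hN := h in ex_intro _ N (asboolT hN)))
  | right _ => None
  end.

Definition dlcm : nat := (\big[lcmn/1%N]_(i < n.+1 | 0 < i) q i)%N.
Definition aa (i : 'I_n.+1) : nat := (dlcm %/ q i)%N.
Definition bb (i j : 'I_n.+1) : nat := (lcmn (q i) (q j) %/ q i)%N.

Local Notation X i := ('X_(inord i) : poly).

Definition phi1 (l : 'I_n.+2) : poly :=
  if (l == 0%N :> nat) then X 0 ^+ dlcm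
  else if (l == 1%N :> nat) then X 0 ^+ (dlcm - q (inord 1)) * X 1
  else if (l == n.+1 :> nat) then X n ^+ aa (inord n)
  else X l.-1 ^+ aa (inord l.-1) + X 0 ^+ (dlcm - q (inord l)) * X l.

Definition phik (k : nat) (l : 'I_(n.*2).+1) : poly :=
  \sum_(i < n.+1) \sum_(j < n.+1 | ((i + j)%N == l) && (i <= j)%N)
     'X_i ^+ (k * aa i - bb i j) * 'X_j ^+ bb j i.

End WPS.

(* Main.v *)
Require Import Defs.
From mathcomp Require Import all_boot all_order all_algebra.
From mathcomp Require Import boolp reals complex mpoly.
From mathcomp Require Import cyclic separable cyclotomic ring zify lra.
From mathcomp Require classical_sets.
Set Implicit Arguments.
Unset Strict Implicit.
Unset Printing Implicit Defensive.
Import Order.TTheory GRing.Theory Num.Theory.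
Local Open Scope ring_scope.

(** The maps [phi1] and [phik] are separating by triangular elimination: once the first nonzero
coordinates agree, the sections determine the remaining coordinates one after the other, up to
[a_i]-th roots of unity; as the [a_i] are pairwise coprime, the Chinese remainder theorem collects
these roots into one scalar [l] with [l ^ d = 1].

For the lower bounds let [f_0, ..., f_N] separate points in degree [M = delta * kappa] with
[kappa >= 2]. In the affine space of pairs [(x, y)] the equations [f_j(x) = f_j(y)] cut out the
graphs [y = l.x] with [l ^ M = 1]. If the weights of the coordinates in [T] divide [delta] and the
other coordinates of [x] are set to zero, the graphs with [l ^ delta = 1] and the others form two
closed cones meeting only in the origin. A cone cut out by at most [m - 2] equations in affine
[m]-space cannot split in this way, whence [N + 1 >= n + #|T|].

That connectedness statement is the Mayer-Vietoris argument of local cohomology: if [F], [a], [b]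
define the union and the two cones and [z] is the system of coordinates, then the class of
[1 / prod z] in the top Cech cohomology of [z] dies on the complements of [V(a)] and of [V(b)], so
it comes from Cech cohomology of the complement of [V(F)] in a degree exceeding the number of
equations; hence it is zero, whereas it is not a sum of fractions with fewer denominators. The
ideal memberships needed for this come from the Nullstellensatz, proved for an uncountable
algebraically closed field. *)

(** * Cech cochains in a field *)

Section RadicalIdeals.
Variables (S : comNzRingType) (I : finType) (f : I -> S).

Definition idl (J : {set I}) (h : S) : Prop :=
  exists u : I -> S, h = \sum_(j in J) u j * f j.

Definition rad (J : {set I}) (h : S) : Prop := exists N, idl J (h ^+ N).

Lemma idl_mull J g h : idl J h -> idl J (g * h).
Proof.
case=> u ->; exists (fun j => g * u j).
by rewrite mulr_sumr; apply: eq_bigr => j _; rewrite mulrA.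
Qed.

Lemma rad_mull J g h : rad J h -> rad J (g * h).
Proof. by case=> N hN; exists N; rewrite exprMn; apply: idl_mull. Qed.

Lemma idl_gen (J : {set I}) j : j \in J -> idl J (f j).
Proof.
move=> jJ; exists (fun i => (i == j)%:R).
rewrite (bigD1 j) //= eqxx mul1r big1 ?addr0 // => i /andP[_ /negbTE ->].
by rewrite mul0r.
Qed.

Lemma radS (J J' : {set I}) h : J \subset J' -> rad J h -> rad J' h.
Proof.
move=> /subsetP JJ' [N [u hN]]; exists N, (fun j => if j \in J then u j else 0).
rewrite hN big_mkcond [RHS]big_mkcond; apply: eq_bigr => j _.
by case: ifP => [/JJ' ->|] //; rewrite mul0r; case: ifP.
Qed.

Lemma rad_prod (J A : {set I}) i : i \in A -> rad J (f i) -> rad J (\prod_(k in A) f k).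
Proof. by move=> iA ri; rewrite (bigD1 i) //= mulrC; apply: rad_mull. Qed.

Lemma rad_prod2 (J A : {set I}) i j :
  i != j -> i \in A -> j \in A -> rad J (f i * f j) -> rad J (\prod_(k in A) f k).
Proof.
move=> ij iA jA ri; rewrite (bigD1 i) //= (bigD1 j) /=; last by rewrite jA eq_sym.
by rewrite mulrA mulrC; apply: rad_mull.
Qed.

(** In the power [Na + Nb] of a sum every binomial term contains [a ^+ Na] or [b ^+ Nb], so powers
    of the generators suffice. Below, [E] is the annihilator of a cohomology class. *)
Lemma power_in_ideal (E : S -> Prop) (J : {set I}) h :
  E 0 -> (forall a b, E a -> E b -> E (a + b)) -> (forall a b, E b -> E (a * b)) ->
  (forall j, j \in J -> exists N, E (f j ^+ N)) -> rad J h -> exists N, E (h ^+ N).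
Proof.
move=> E0 ED EM Ef [N [u hN]].
suff [M EMh] : exists M, E ((\sum_(j in J) u j * f j) ^+ M).
  by exists (N * M)%N; rewrite exprM hN.
elim/big_ind: _ => [|a b [Na Ea] [Nb Eb]|j jJ].
- by exists 1%N; rewrite expr1.
- exists (Na + Nb)%N; rewrite exprDn.
  elim/big_ind: _ => // i _; rewrite -mulr_natl; apply: (EM _%:R).
  have [le|lt] := leqP Nb i; first by rewrite -(subnK le) exprD mulrA; apply: EM.
  have -> : (Na + Nb - i = (Nb - i) + Na)%N by lia.
  by rewrite exprD mulrAC; apply: EM.
- by have [M EMj] := Ef j jJ; exists M; rewrite exprMn; apply: EM.
Qed.

End RadicalIdeals.

Section Cech.
Variables (S : comNzRingType) (K : fieldType) (iota : {rmorphism S -> K}).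
Variables (I : finType) (f : I -> S).

(** Stands for the localization of [S] at [g], seen inside [K]; if [iota g = 0] it is all of [K]. *)
Definition loc (g : S) (x : K) : Prop := exists N p, iota g ^+ N * x = iota p.

Lemma loc0 g : loc g 0.
Proof. by exists 0%N, 0; rewrite mulr0 rmorph0. Qed.

Lemma locD g x y : loc g x -> loc g y -> loc g (x + y).
Proof.
case=> [N [p Hp]] [M [r Hr]]; exists (N + M)%N, (g ^+ M * p + g ^+ N * r).
by rewrite rmorphD !rmorphM !rmorphXn /= -Hp -Hr exprD; ring.
Qed.

Lemma locM g p x : loc g x -> loc g (iota p * x).
Proof.
by case=> [N [r Hr]]; exists N, (p * r); rewrite rmorphM -Hr /= mulrCA.
Qed.

Lemma locN g x : loc g x -> loc g (- x).
Proof. by move=> /(locM (-1)); rewrite rmorphN1 mulN1r. Qed.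

Lemma loc_mul g h x : loc g x -> loc (h * g) x.
Proof.
case=> [N [p Hp]]; exists N, (h ^+ N * p).
by rewrite !rmorphM !rmorphXn /= -Hp exprMn mulrA.
Qed.

Lemma loc_mul_out g h x : loc (h * g) x -> exists N, loc g (iota h ^+ N * x).
Proof.
case=> [N [p Hp]]; exists N, N, p; rewrite -Hp rmorphM exprMn; ring.
Qed.

Lemma loc_null g x : iota g = 0 -> loc g x.
Proof. by move=> g0; exists 1%N, 0; rewrite g0 expr1 mul0r rmorph0. Qed.

Lemma loc_div g h N x : loc (h * g) x -> loc (h * g) (iota h ^- N * x).
Proof.
have [h0 _|h0] := eqVneq (iota h) 0.
  by apply: loc_null; rewrite rmorphM h0 mul0r.
case=> [M [p Hp]]; exists (M + N)%N, (g ^+ N * p).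
rewrite !rmorphM !rmorphXn /= -Hp exprD rmorphM /= !exprMn.
by field; rewrite expf_neq0.
Qed.

(** Augmented Cech cochains for the open sets [f i != 0]. All degrees live in one function on sets
    of indices; [pure] singles out a degree, [regular] bounds the denominators and [supp] confines a
    cochain to a region. *)
Definition cochain := {set I} -> K.
Implicit Types (c x y : cochain) (A B J : {set I}) (Q : pred {set I}).

Definition fset_prod A : S := \prod_(i in A) f i.

Definition sgn (i : I) A : K := (-1) ^+ #|[set j in A | (enum_rank j < enum_rank i)%N]|.

Definition cD c : cochain := fun A => \sum_(i in A) sgn i A * c (A :\ i).

Definition regular c := forall A, loc (fset_prod A) (c A).
Definition supp Q c := forall A, ~~ Q A -> c A = 0.
Definition pure e c := forall A, c A <> 0 -> #|A| = e.
Definition cut Q c : cochain := fun A => if Q A then c A else 0.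
Definition cadd c x : cochain := fun A => c A + x A.
Definition copp c : cochain := fun A => - c A.

Lemma sgnK i A : sgn i A * sgn i A = 1.
Proof. by rewrite /sgn -expr2 -exprM mulnC exprM sqrrN !expr1n. Qed.

Lemma sgn_swap A i j : i \in A -> j \in A -> i != j ->
  sgn i A * sgn j (A :\ i) = - (sgn j A * sgn i (A :\ j)).
Proof.
wlog lt_ij : i j / (enum_rank i < enum_rank j)%N => [H iA jA ij|].
  have [lt|lt|/val_inj/enum_rank_inj e] := ltngtP (enum_rank i) (enum_rank j).
  - exact: H.
  - by rewrite (H j i) ?opprK // eq_sym.
  - by rewrite e eqxx in ij.
move=> iA jA ij.
have -> : sgn i (A :\ j) = sgn i A.
  congr (_ ^+ _); apply: eq_card => k; rewrite !inE; case: eqP => // ->.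
  by rewrite jA /= ltnNge ltnW.
have -> : sgn j A = - sgn j (A :\ i).
  rewrite /sgn [X in (-1) ^+ X](cardsD1 i) !inE iA lt_ij /= exprS mulN1r.
  congr (- (_ ^+ _)); apply: eq_card => k; rewrite !inE.
  by rewrite andbA.
by rewrite mulNr opprK mulrC.
Qed.

(** The two orders of removing a pair of indices carry opposite signs by [sgn_swap]. *)
Lemma cDD c A : cD (cD c) A = 0.
Proof.
pose G i j := if [&& i \in A, j \in A & i != j]
  then sgn i A * (sgn j (A :\ i) * c (A :\ i :\ j)) else 0.
have GN i j : G j i = - G i j.
  rewrite /G; case: (boolP (i \in A)) => iA; case: (boolP (j \in A)) => jA /=;
    rewrite ?oppr0 // eq_sym; case: ifP => ij; rewrite ?oppr0 //.
  rewrite !mulrA (sgn_swap jA iA) 1?eq_sym // mulNr; congr (- (_ * c _)).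
  by apply/setP => k; rewrite !inE andbCA.
transitivity (\sum_i \sum_j G i j).
  rewrite /cD big_mkcond /=; apply: eq_bigr => i _; rewrite /G.
  case: (boolP (i \in A)) => iA; last by rewrite big1.
  rewrite mulr_sumr [LHS]big_mkcond; apply: eq_bigr => j _.
  by rewrite !inE /= andbC eq_sym.
have Gii i : G i i = 0 by rewrite /G eqxx !andbF.
rewrite pair_bigA /= (bigID (fun p => enum_rank p.1 < enum_rank p.2)%N) /=.
rewrite [X in _ + X](bigID (fun p => p.1 == p.2)) /=.
rewrite [X in _ + (X + _)]big1 ?add0r; last by move=> [i j] /= /andP[_ /eqP ->].
rewrite [X in _ + X](reindex_inj (h := fun p => (p.2, p.1))) /=; last first.
  by move=> [? ?] [? ?] [-> ->].
rewrite [X in _ + X](eq_bigl (fun p => enum_rank p.1 < enum_rank p.2)%N); last first.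
  move=> [i j] /=; rewrite -leqNgt leq_eqVlt; case: (eqVneq j i) => [->|ij].
    by rewrite andbF ltnn.
  by rewrite andbT; case: eqP => // /val_inj/enum_rank_inj/esym/eqP; rewrite (negbTE ij).
by rewrite -big_split big1 //= => [[i j]] _; rewrite [X in _ + X]GN addrN.
Qed.

Lemma cD_add c x A : cD (cadd c x) A = cD c A + cD x A.
Proof. by rewrite /cD -big_split; apply: eq_bigr => i _; rewrite mulrDr. Qed.

Lemma cD_opp c A : cD (copp c) A = - cD c A.
Proof. by rewrite /cD -sumrN; apply: eq_bigr => i _; rewrite mulrN. Qed.

Lemma eq_cD c x A : (forall i, i \in A -> c (A :\ i) = x (A :\ i)) -> cD c A = cD x A.
Proof. by move=> H; apply: eq_bigr => i iA; rewrite H. Qed.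

Lemma cD_eq0 c A : (forall i, i \in A -> c (A :\ i) = 0) -> cD c A = 0.
Proof. by move=> H; apply: big1 => i iA; rewrite H ?mulr0. Qed.

Lemma cD_neq0 c A : cD c A <> 0 -> exists2 i, i \in A & c (A :\ i) <> 0.
Proof.
move=> h; apply: contrapT => n; apply: h; apply: cD_eq0 => i iA.
by apply: contrapT => h; apply: n; exists i.
Qed.

Lemma fset_prodD1 A i : i \in A -> fset_prod A = f i * fset_prod (A :\ i).
Proof. by move=> iA; rewrite /fset_prod (big_setD1 i). Qed.

Lemma regular_cD c : regular c -> regular (cD c).
Proof.
move=> rc A; rewrite /cD; elim/big_ind: _ => [|x y|i iA]; [exact: loc0|exact: locD|].
rewrite /sgn -(rmorphN1 iota) -rmorphXn; apply: locM.
by rewrite (fset_prodD1 iA); apply: loc_mul.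
Qed.

Lemma regular_cut Q c : regular c -> regular (cut Q c).
Proof. by move=> rc A; rewrite /cut; case: ifP => // _; apply: loc0. Qed.

Lemma regular_add c x : regular c -> regular x -> regular (cadd c x).
Proof. by move=> rc rx A; apply: locD. Qed.

Lemma regular_opp c : regular c -> regular (copp c).
Proof. by move=> rc A; apply: locN. Qed.

Lemma supp_cut Q c : supp Q (cut Q c).
Proof. by move=> A /negbTE h; rewrite /cut h. Qed.

Lemma pure_cD e c : pure e c -> pure e.+1 (cD c).
Proof.
by move=> hc A /cD_neq0[i iA /hc <-]; rewrite [LHS](cardsD1 i) iA.
Qed.

Lemma pure_cut e Q c : pure e c -> pure e (cut Q c).
Proof. by move=> hc A; rewrite /cut; case: ifP => // _; apply: hc. Qed.

Lemma pure_add e c x : pure e c -> pure e x -> pure e (cadd c x).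
Proof.
move=> hc hx A; rewrite /cadd => h; have [c0|/eqP] := eqVneq (c A) 0; last exact: hc.
by apply: hx => x0; apply: h; rewrite c0 x0 addr0.
Qed.

Lemma pure_opp e c : pure e c -> pure e (copp c).
Proof. by move=> hc A h; apply: hc => c0; apply: h; rewrite /copp c0 oppr0. Qed.

(** Cutting only drops faces outside [Q]; where the coboundary vanishes on those faces, [cDD]
    survives the cut. *)
Lemma cD_cutD Q c A : Q A ->
  (forall i, i \in A -> ~~ Q (A :\ i) -> cD c (A :\ i) = 0) -> cD (cut Q (cD c)) A = 0.
Proof.
move=> QA H; rewrite -[RHS](cDD c A); apply: eq_cD => i iA.
by rewrite /cut; case: ifPn => // nQ; rewrite H.
Qed.

(** Homotopy of the cone with vertex [j]; it brings in the denominator [f j], so it is regular only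
    after inverting [f j]. *)
Definition contract j x : cochain :=
  fun A => if j \in A then 0 else sgn j (j |: A) * x (j |: A).

(** If [j] lies in [A], the face [A :\ j] alone contributes; otherwise closedness of [x] at [j |: A]
    expresses [x A] by the other faces. *)
Lemma contractK j x A : cD x (j |: A) = 0 -> cD (contract j x) A = x A.
Proof.
move=> cl; case: (boolP (j \in A)) => jA.
  rewrite /cD (bigD1 j) //= big1 => [|i /andP[iA ij]]; last first.
    by rewrite /contract !inE eq_sym ij jA mulr0.
  by rewrite addr0 /contract !inE eqxx /= setD1K // mulrA sgnK mul1r.
have {cl} := congr1 (fun u => sgn j (j |: A) * u) cl.
rewrite mulr0 /cD (bigD1 j) ?setU11 //= mulrDr mulrA sgnK mul1r setU1K //.
move/eqP; rewrite addr_eq0 => /eqP ->.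
rewrite mulr_sumr -sumrN; apply: congr_big => // [i|i iA].
  by rewrite !inE; case: eqVneq => [->|]; rewrite ?(negbTE jA) ?andbT.
have ij : i != j by apply: contraNneq jA => <-.
rewrite /contract !inE eq_sym (negbTE ij) (negbTE jA) /=.
have -> : j |: A :\ i = (j |: A) :\ i.
  by apply/setP => k; rewrite !inE; case: (eqVneq k j) => // ->; rewrite eq_sym ij.
have := @sgn_swap (j |: A) i j; rewrite setU11 setU1r // setU1K // => /(_ isT isT ij) e.
rewrite !mulrA -mulNr; congr (_ * _).
transitivity (- (sgn j (j |: A) * sgn i (j |: A)) * (sgn i A * sgn i A)).
  by rewrite -[sgn j (_ :\ i)]mul1r -(sgnK i (j |: A)) -(mulrA (sgn i _)) e; ring.
by rewrite sgnK mulr1.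
Qed.


Definition exact_on Q e x := exists y : cochain,
  [/\ regular y, supp Q y, forall A, y A <> 0 -> #|A|.+1 = e &
      forall A, Q A -> cD y A = x A].

Lemma loc_exp_le (g h : S) (N M : nat) (u : K) : (N <= M)%N ->
  loc g (iota h ^+ N * u) -> loc g (iota h ^+ M * u).
Proof.
by move=> le H; rewrite -(subnK le) exprD -mulrA -rmorphXn; apply: locM.
Qed.

(* The annihilators of the class of [x] form an ideal containing a power of every [f j] with
   [j] in [J]: after inverting [f j] the complex is contracted by [contract j]. *)
Lemma leaf_exact B J e x : J != set0 -> [disjoint B & J] -> rad f J (fset_prod B) ->
  let Q := fun A => A :\: J == B in
  regular x -> supp Q x -> pure e x -> (forall A, Q A -> cD x A = 0) -> exact_on Q e x.
Proof.
move=> /set0Pn[j0 j0J] dBJ rB Q rx sx hx cx.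
have QU j A : j \in J -> Q (j |: A) = Q A.
  move=> jJ; rewrite /Q; congr (_ == _); apply/setP => k; rewrite !inE.
  by case: eqVneq => // ->; rewrite jJ.
have cK j A : j \in J -> Q A -> cD (contract j x) A = x A.
  by move=> jJ QA; apply: contractK; apply: cx; rewrite QU.
have sK j : j \in J -> supp Q (contract j x).
  move=> jJ A nQ; rewrite /contract; case: ifP => // jA.
  by rewrite sx ?mulr0 // QU.
have hK j A : contract j x A <> 0 -> #|A|.+1 = e.
  rewrite /contract; case: ifPn => // jA h.
  by rewrite -(hx (j |: A)) ?cardsU1 ?jA // => x0; apply: h; rewrite x0 mulr0.
have rK j A : loc (f j * fset_prod A) (contract j x A).
  rewrite /contract; case: ifPn => jA; first exact: loc0.
  rewrite /sgn -(rmorphN1 iota) -rmorphXn; apply: locM.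
  by have := rx (j |: A); rewrite (@fset_prodD1 (j |: A) j) ?setU11 // setU1K.
have QB A : Q A -> fset_prod A = fset_prod B * fset_prod (A :&: J).
  move=> /eqP <-; rewrite /fset_prod (big_setID J) /= mulrC.
  by congr (_ * _).
(* If the product over [B] is zero in [K], regularity on the leaf is void and a single contraction
   suffices. *)
have [B0|B0] := eqVneq (iota (fset_prod B)) 0.
  exists (contract j0 x); split; [|exact: sK|exact: hK|by move=> A; apply: cK].
  move=> A; have [/QB ->|/(sK _ j0J) ->] := boolP (Q A); last exact: loc0.
  by apply: loc_null; rewrite rmorphM B0 mul0r.
pose E h := exact_on Q e (fun A => iota h * x A).
have [N [y [ry sy hy Dy]]] : exists N, E (fset_prod B ^+ N).
  apply: (power_in_ideal _ _ _ _ rB) =>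
    [|a b [y [ry sy hy Dy]] [z [rz sz hz Dz]]|a b [y [ry sy hy Dy]]|j jJ].
  - exists (fun _ => 0); split=> // [A|A QA]; first exact: loc0.
    by rewrite cD_eq0 // rmorph0 mul0r.
  - exists (cadd y z); split=> [|A nQ|A|A QA].
    + exact: regular_add.
    + by rewrite /cadd sy ?sz ?addr0.
    + rewrite /cadd => h; have [y0|/eqP] := eqVneq (y A) 0; last exact: hy.
      by apply: hz => z0; apply: h; rewrite y0 z0 addr0.
    + by rewrite cD_add Dy ?Dz // rmorphD mulrDl.
  - exists (fun A => iota a * y A); split=> [A|A nQ|A h|A QA].
    + exact: locM.
    + by rewrite sy ?mulr0.
    + by apply: hy => y0; apply: h; rewrite y0 mulr0.
    + rewrite rmorphM -mulrA -Dy // /cD mulr_sumr; apply: eq_bigr => i _.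
      by rewrite mulrCA.
  (* One exponent [N] clears the denominator [f j] of the contraction at all index sets at once. *)
  - have [N HN] : exists N, forall A, loc (fset_prod A) (iota (f j) ^+ N * contract j x A).
      have [n_ Hn] := choice (fun A => loc_mul_out (rK j A)).
      exists (\max_A n_ A)%N => A; apply: loc_exp_le (Hn A).
      exact: (leq_bigmax A).
    exists N, (fun A => iota (f j) ^+ N * contract j x A); split=> // [A nQ|A h|A QA].
    + by rewrite sK ?mulr0.
    + by apply: (hK j) => y0; apply: h; rewrite y0 mulr0.
    + rewrite rmorphXn -(cK j) // /cD mulr_sumr; apply: eq_bigr => i _.
      by rewrite mulrCA.
(* On the leaf the product over [B] is a unit, so its power can be divided out of the primitive. *)
exists (fun A => iota (fset_prod B) ^- N * y A); split=> [A|A nQ|A h|A QA].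
- have [QA|/sy ->] := boolP (Q A); last by rewrite mulr0; apply: loc0.
  by move: (ry A); rewrite QB // => ?; apply: loc_div.
- by rewrite sy ?mulr0.
- by apply: hy => y0; apply: h; rewrite y0 mulr0.
- transitivity (iota (fset_prod B) ^- N * cD y A).
    by rewrite /cD mulr_sumr; apply: eq_bigr => i _; rewrite mulrCA.
  by rewrite Dy // rmorphXn mulrA mulVf ?mul1r // expf_neq0.
Qed.

(** These are the locally closed families of index sets: cochains supported there form a subquotient
    of the full complex. *)
Definition convex Q := forall A B C, Q A -> Q C -> A \subset B -> B \subset C -> Q B.

(* Exactness is proved one value of [A :\: J] at a time, in order of increasing cardinal. *)
Lemma region_exact Q J e x : J != set0 -> convex Q ->
  (forall A j, j \in J -> Q (j |: A) = Q A) ->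
  (forall A, Q A -> rad f J (fset_prod (A :\: J))) ->
  regular x -> supp Q x -> pure e x -> (forall A, Q A -> cD x A = 0) -> exact_on Q e x.
Proof.
move=> J0 cQ QU rQ.
have QJ A : Q (A :\: J) = Q A.
  have [s] := ubnP #|A :&: J|; elim: s A => // s IH A lt.
  have [AJ0|/set0Pn[j]] := eqVneq (A :&: J) set0.
    by congr (Q _); apply/setDidPl; rewrite -setI_eq0 AJ0.
  rewrite inE => /andP[jA jJ]; rewrite -[in RHS](setD1K jA) QU // -[in RHS]IH.
    congr (Q _); apply/setP => k; rewrite !inE.
    by case: eqVneq => [->|]; rewrite ?jJ.
  rewrite ltnS in lt; apply: leq_trans lt; apply: proper_card.
  apply/properP; split; first by apply: setSI; rewrite subD1set.
  by exists j; rewrite !inE ?jA ?jJ ?eqxx.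
(* [s] is the number of values of [#|A :\: J|] still to be treated: for [s = #|I|.+1] the vanishing
   condition is void, for [s = 0] it says [x = 0]. *)
suff main s : forall x, (forall A, (#|A :\: J| + s < #|I|.+1)%N -> x A = 0) ->
  regular x -> supp Q x -> pure e x -> (forall A, Q A -> cD x A = 0) -> exact_on Q e x.
  move=> rx sx hx cx; apply: (main #|I|.+1) => // A.
  by rewrite ltnNge (leq_trans _ (leq_addl _ _)).
elim: s => [|s IH] {}x x0 rx sx hx cx.
  exists (fun _ => 0); split=> // [A|A QA]; first exact: loc0.
  by rewrite cD_eq0 // x0 // addn0 ltnS max_card.
pose lev A := (#|A :\: J| + s.+1 == #|I|.+1)%N.
have /choice[Y HY] B : exists y, (B :&: J = set0 -> Q B -> lev B ->
    [/\ regular y, supp (fun A => A :\: J == B) y, forall A, y A <> 0 -> #|A|.+1 = e &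
      forall A, A :\: J == B -> cD y A = x A]).
  have [[BJ QB lB]|n] := pselect [/\ B :&: J = set0, Q B & lev B]; last first.
    by exists (fun _ => 0) => *; case: n.
  have dBJ : [disjoint B & J] by rewrite -setI_eq0 BJ.
  have BJB : B :\: J = B by apply/setDidPl.
  have leafQ A : A :\: J == B -> Q A by rewrite -QJ => /eqP ->.
  case: (@leaf_exact B J e (cut (fun A => A :\: J == B) x)) => //.
  - by have := rQ B QB; rewrite BJB.
  - exact: regular_cut.
  - exact: supp_cut.
  - exact: pure_cut.
  - move=> A AB; rewrite -[RHS](cx A) ?leafQ //; apply: eq_cD => i iA; rewrite /cut.
    case: ifPn => // nAB; rewrite x0 //.
    have iJ : i \notin J.
      apply: contra nAB => iJ; rewrite -(eqP AB); apply/eqP/setP => k; rewrite !inE.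
      by case: eqVneq => // ->; rewrite iJ.
    move/eqP: lB; rewrite BJB -(eqP AB) (cardsD1 i) !inE iA iJ /=.
    have -> : (A :\ i) :\: J = (A :\: J) :\ i by rewrite !setDDl setUC.
    by lia.
  - move=> y [ry sy hy Dy]; exists y => _ _ _; split=> // A AB.
    by rewrite Dy // /cut AB.
(* The primitives on the leaves of this level are glued; a face of [A] in another leaf has smaller
   [#|A :\: J|], so the leaves do not interfere. *)
pose y A := if Q A && lev A then Y (A :\: J) A else 0.
have HYA A : Q A -> lev A -> [/\ regular (Y (A :\: J)),
    supp (fun B => B :\: J == A :\: J) (Y (A :\: J)),
    forall B, Y (A :\: J) B <> 0 -> #|B|.+1 = e &
    forall B, B :\: J == A :\: J -> cD (Y (A :\: J)) B = x B].
  move=> QA lA; apply: HY; rewrite ?QJ //.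
    by apply/setP => k; rewrite !inE; case: (k \in J); rewrite ?andbF.
  by move: lA; rewrite /lev setDDl setUid.
have ry : regular y.
  move=> A; rewrite /y; case: ifP => [/andP[QA lA]|_]; last exact: loc0.
  by have [+ _ _ _] := HYA A QA lA; apply.
have sy : supp Q y by move=> A /negbTE nQ; rewrite /y nQ.
have hy A : y A <> 0 -> #|A|.+1 = e.
  rewrite /y; case: ifP => // /andP[QA lA].
  by have [_ _ + _] := HYA A QA lA; apply.
have Dy A : Q A -> lev A -> cD y A = x A.
  move=> QA lA; have [_ sY _ /(_ A (eqxx _)) <-] := HYA A QA lA.
  apply: eq_cD => i iA; have [iJ|iJ] := boolP (i \in J).
    have e1 : (A :\ i) :\: J = A :\: J.
      by apply/setP => k; rewrite !inE; case: eqVneq => // ->; rewrite iJ.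
    by rewrite /y /lev -QJ e1 QJ QA; move: lA; rewrite /lev => ->.
  have e1 : (A :\ i) :\: J = (A :\: J) :\ i by rewrite !setDDl setUC.
  have lt : (#|(A :\ i) :\: J| < #|A :\: J|)%N.
    by rewrite e1 [X in (_ < X)%N](cardsD1 i) !inE iA iJ.
  rewrite sY; last by apply/negP => /eqP e2; move: lt; rewrite e2 ltnn.
  rewrite /y; case: ifP => // /andP[_ /eqP lA'].
  by move/eqP: lA; lia.
pose x' := cadd x (copp (cut Q (cD y))).
have dy A i : Q A -> i \in A -> ~~ Q (A :\ i) -> cD y (A :\ i) = 0.
  move=> QA iA nQ; apply: cD_eq0 => k kA; apply: sy; apply: contra nQ => Qk.
  by apply: (cQ _ _ _ Qk QA); rewrite subD1set.
have [||||A QA|z [rz sz hz Dz]] := IH x'.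
- move=> A lt; rewrite /x' /cadd /copp /cut.
  case: ifPn => [QA|nQ]; last by rewrite sx // oppr0 addr0.
  have [lA|lA] := boolP (lev A); first by rewrite Dy // addrN.
  rewrite x0; last by move: lA; rewrite /lev; lia.
  rewrite add0r cD_eq0 ?oppr0 // => i iA; rewrite /y; case: ifP => // /andP[_ /eqP].
  have : (#|A :\ i :\: J| <= #|A :\: J|)%N.
    by apply: subset_leq_card; apply: setSD; rewrite subD1set.
  by move: lt lA; rewrite /lev; lia.
- by apply: regular_add => //; apply: regular_opp; apply: regular_cut; apply: regular_cD.
- by move=> A nQ; rewrite /x' /cadd /copp /cut (negbTE nQ) oppr0 addr0 sx.
- apply: pure_add => //; apply: pure_opp; apply: pure_cut => A /cD_neq0[i iA /hy <-].
  by rewrite (cardsD1 i) iA.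
- rewrite /x' cD_add cx // add0r cD_opp cD_cutD ?oppr0 // => i iA.
  exact: dy.
exists (cadd z y); split=> [|A nQ|A|A QA].
- exact: regular_add.
- by rewrite /cadd sz ?sy ?addr0.
- rewrite /cadd => h; have [z0|/eqP] := eqVneq (z A) 0; last exact: hz.
  by apply: hy => y0; apply: h; rewrite z0 y0 addr0.
- by rewrite cD_add Dz // /x' /cadd /copp /cut QA subrK.
Qed.

End Cech.

(** * The Mayer-Vietoris argument *)

Section Connectedness.
Variables (S : comNzRingType) (K : fieldType) (iota : {rmorphism S -> K}).
Variables (I : finType) (f : I -> S) (k : I -> nat).
Implicit Types (A B : {set I}) (x y : cochain K I).

(* The index classes 0, 1, 2, 3 carry the equations [F], [a], [b] and the coordinates [z]. *)
Let P j : {set I} := [set i | k i == j].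
Let has j A := A :&: P j != set0.

Let up (Q : pred {set I}) := forall A B, A \subset B -> Q A -> Q B.

Let up_has j : up (has j).
Proof.
move=> A B AB; rewrite /has -!card_gt0 => h.
exact: leq_trans h (subset_leq_card (setSI _ AB)).
Qed.

Let up_mem z : up (fun A => z \in A).
Proof. by move=> A B /subsetP; apply. Qed.

Let hasP j A : reflect (exists2 i, i \in A & k i = j) (has j A).
Proof.
apply: (iffP (set0Pn _)) => [[l]|[l lA kl]]; last by exists l; rewrite !inE lA kl eqxx.
by rewrite !inE => /andP[lA /eqP kl]; exists l.
Qed.

Let hasU j A i : has j (i |: A) = (k i == j) || has j A.
Proof.
apply/hasP/orP => [[l]|[/eqP ki|/hasP[l lA kl]]].
- by rewrite !inE => /orP[/eqP ->|lA] kl; [left; rewrite kl eqxx|right; apply/hasP; exists l].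
- by exists i; rewrite ?setU11.
- by exists l; rewrite ?setU1r.
Qed.

Let hasD1 j A i : has j (A :\ i) -> has j A.
Proof. by apply: up_has; rewrite subD1set. Qed.

Let convexI Q Q' : convex Q -> convex Q' -> convex (fun A : {set I} => Q A && Q' A).
Proof.
move=> c c' A B C /andP[a a'] /andP[b b'] AB BC.
by rewrite (c A B C) ?(c' A B C).
Qed.

Let convexU Q : up Q -> convex Q.
Proof. by move=> u A B C a _ AB _; apply: u AB a. Qed.

Let convexN Q : up Q -> convex (fun A => ~~ Q A).
Proof. by move=> u A B C _ c _ BC; apply: contra c; apply: u. Qed.

Let suppW (Q Q' : pred {set I}) x : supp Q x -> (forall A, Q A -> Q' A) -> supp Q' x.
Proof. by move=> sx QQ' A nQ; apply: sx; apply: contra nQ; apply: QQ'. Qed.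

Let suppU Q x A : up Q -> supp Q x -> ~~ Q A -> cD x A = 0.
Proof.
move=> uQ sx nQ; apply: cD_eq0 => i iA; apply: sx; apply: contra nQ.
by apply: uQ; rewrite subD1set.
Qed.

Lemma rad_has (J : {set I}) j A :
  (forall i, i \in J -> k i != j) -> (forall i, k i = j -> rad f J (f i)) -> has j A ->
  rad f J (fset_prod f (A :\: J)).
Proof.
move=> nJ rJ /hasP[i iA ki]; apply: (rad_prod _ (rJ i ki)).
by rewrite !inE iA andbT; apply/negP => /nJ; rewrite ki eqxx.
Qed.

Variables z1 z2 : I.
Hypothesis kz1 : k z1 = 3%N.
Hypothesis kz2 : k z2 = 3%N.
Hypothesis kle : forall i, (k i < 4)%N.
Hypothesis P0n : P 0 != set0.
Hypothesis P1n : P 1 != set0.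
Hypothesis P2n : P 2 != set0.
Hypothesis rad1 : forall i, k i = 1%N -> rad f (P 3 :\ z1) (f i).
Hypothesis rad2 : forall i, k i = 2%N -> rad f (P 3 :\ z2) (f i).
Hypothesis rad3 : forall i, k i = 3%N -> rad f (P 1 :|: P 2) (f i).
Hypothesis rad12 : forall i j, k i = 1%N -> k j = 2%N -> rad f (P 0) (f i * f j).
Hypothesis rad01 : forall i, k i = 0%N -> rad f (P 1) (f i).
Hypothesis rad02 : forall i, k i = 0%N -> rad f (P 2) (f i).
Hypothesis card03 : (#|P 0|.+1 < #|P 3|)%N.

Let c0 : cochain K I := fun A => if A == P 3 then (iota (fset_prod f (P 3)))^-1 else 0.
Let m := #|P 3|.

Let reg_c0 : regular iota f c0.
Proof.
move=> A; rewrite /c0; case: eqP => [->|_]; last exact: loc0.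
have [g0|g0] := eqVneq (iota (fset_prod f (P 3))) 0; first exact: loc_null.
by exists 1%N, 1; rewrite expr1 mulfV // rmorph1.
Qed.

Let hom_c0 : pure m c0.
Proof. by move=> A; rewrite /c0; case: eqP => // ->. Qed.

(** The [z]-axis lies in the cone of class [l], so off this cone the coordinates other than [z] have
    no common zero. Hence [1 / prod z] dies there, and [x] extends [c0] to a cocycle on index sets
    of classes [l] and 3. The pair [(l, l')] treats both cones at once. *)
Let half l l' z : (l, l') \in [:: (1, 2); (2, 1)]%N -> k z = 3%N ->
  (forall i, k i = l -> rad f (P 3 :\ z) (f i)) ->
  exists x, [/\ regular iota f x,
    supp (fun A => [&& ~~ has 0 A, ~~ has l' A, has l A & z \in A]) x, pure m x &
    forall A, ~~ has 0 A -> ~~ has l' A -> cD (cadd c0 x) A = 0].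
Proof.
move=> ll kz rl; pose Q A := [&& ~~ has 0 A, ~~ has l' A, has l A & z \in A].
have l_3 : l != 3 /\ l' != 3 by case/orP: ll => [/eqP[-> ->]|/orP[/eqP[-> ->]|]].
have Dc0 A : ~~ has 0 A -> ~~ has l' A -> ~~ Q A -> cD c0 A = 0.
  move=> n0 nl' nQ; apply: contrapT => /cD_neq0[i iA]; rewrite /c0.
  case: eqP => // e _; case/negP: nQ; rewrite /Q n0 nl' /=; apply/andP; split.
    apply/hasP; exists i => //; have := kle i.
    have : k i != 0%N by apply: contra n0 => /eqP ki; apply/hasP; exists i.
    have : k i != l' by apply: contra nl' => /eqP ki; apply/hasP; exists i.
    have : k i != 3%N by have := setD11 i A; rewrite e inE => ->.
    by case/orP: ll => [/eqP[-> ->]|/orP[/eqP[-> ->]|]] //; lia.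
  have /subsetP := subD1set A i; rewrite e; apply.
  by rewrite inE kz.
have cQ : convex Q.
  exact: convexI (convexN (@up_has 0)) (convexI (convexN (@up_has l'))
    (convexI (convexU (@up_has l)) (convexU (@up_mem z)))).
have [||A j|A|||||y [ry sy hy Dy]] := @region_exact S K iota I f Q (P 3 :\ z) m.+1 (cut Q (cD c0)).
- by rewrite -card_gt0; move: card03; rewrite (cardsD1 z (P 3)) inE kz eqxx; case: #|_ :\ z|.
- exact: cQ.
- rewrite !inE => /andP[jz /eqP kj]; rewrite /Q !hasU kj !inE (eq_sym z j) (negbTE jz) /=.
  by case: l_3 => l3 l'3; rewrite ![3%N == _]eq_sym (negbTE l3) (negbTE l'3).
- case/and4P=> _ _ hl _; apply: rad_has hl => // i; rewrite !inE => /andP[_ /eqP ->].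
  by rewrite eq_sym; case: l_3.
- by apply: regular_cut; apply: regular_cD.
- exact: supp_cut.
- by apply: pure_cut; apply: pure_cD.
- move=> A QA; apply: cD_cutD => // i iA nQ; apply: Dc0 => //.
    by case/and4P: QA => n0 _ _ _; apply: contra n0; apply: hasD1.
  by case/and4P: QA => _ n0 _ _; apply: contra n0; apply: hasD1.
exists (copp y); split=> [|A nQ|A yA|A n0 nl'].
- exact: regular_opp.
- by rewrite /copp sy ?oppr0.
- by have /hy[] : y A <> 0 by move=> y0; apply: yA; rewrite /copp y0 oppr0.
rewrite cD_add cD_opp; have [QA|nQ] := boolP (Q A).
  by rewrite Dy // /cut QA addrN.
rewrite Dc0 // add0r cD_eq0 ?oppr0 // => i iA; apply: sy; apply: contra nQ.
case/and4P=> _ _ hl zA; rewrite /Q n0 nl' (hasD1 hl) /=.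
by move: zA; rewrite !inE => /andP[].
Qed.

(** A diagram chase in the Cech complex of all four classes: every call of [region_exact] exploits
    one radical hypothesis to find a primitive on one region of index sets. *)
Lemma connectedness_residue : exists2 y, regular iota f y &
  cD y (P 3) = (iota (fset_prod f (P 3)))^-1.
Proof.
have [xa [ra sa ha Da]] := half (l := 1) (l' := 2) isT kz1 rad1.
have [xb [rb sb hb Db]] := half (l := 2) (l' := 1) isT kz2 rad2.
(* [c0] is corrected off both cones; away from class 0, the rest of its coboundary sits on sets
   meeting both classes 1 and 2. *)
pose u := cadd (cadd c0 xa) xb.
have sa1 : supp (has 1) xa by apply: suppW sa _ => A /and4P[].
have sb2 : supp (has 2) xb by apply: suppW sb _ => A /and4P[].
have Du A : ~~ has 0 A -> ~~ (has 1 A && has 2 A) -> cD u A = 0.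
  move=> n0; rewrite negb_and => /orP[n1|n2]; rewrite /u !cD_add.
    by rewrite (suppU (@up_has 1) sa1) // addr0 -cD_add Db.
  by rewrite (suppU (@up_has 2) sb2) // addr0 -cD_add Da.
have ru : regular iota f u by do !apply: regular_add.
have hu : pure m u by do !apply: pure_add.
(* As class 1 lies in the radical of the coordinates, this rest is a coboundary too, which makes [X]
   a cocycle on all sets without class 0. *)
pose R1 A := ~~ has 0 A && (has 1 A && has 2 A).
have [||A j|A|||||y [ry sy hy Dy]] := @region_exact S K iota I f R1 (P 3) m.+1 (cut R1 (cD u)).
- by rewrite -card_gt0; apply: leq_trans card03.
- exact: convexI (convexN (@up_has 0)) (convexI (convexU (@up_has 1)) (convexU (@up_has 2))).
- by rewrite !inE => /eqP kj; rewrite /R1 !hasU kj.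
- case/and3P=> _ h1 _; apply: rad_has h1 => i; first by rewrite inE => /eqP ->.
  by move/rad1; apply: radS; rewrite subD1set.
- by apply: regular_cut; apply: regular_cD.
- exact: supp_cut.
- by apply: pure_cut; apply: pure_cD.
- move=> A R1A; have /andP[n0 _] := R1A; apply: cD_cutD => // i iA.
  rewrite /R1 negb_and negbK => /orP[h0|].
    by case/negP: n0; apply: hasD1 h0.
  by apply: Du; apply: contra n0; apply: hasD1.
pose X := cadd u (copp y).
have hy' : pure m y by move=> A /hy[].
have rX : regular iota f X by apply: regular_add => //; apply: regular_opp.
have hX : pure m X by apply: pure_add => //; apply: pure_opp.
have DX A : ~~ has 0 A -> cD X A = 0.
  move=> n0; rewrite cD_add cD_opp; have [h12|n12] := boolP (has 1 A && has 2 A).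
    by rewrite Dy /R1 ?n0 ?h12 // /cut /R1 n0 h12 addrN.
  rewrite Du // add0r (cD_eq0 (c := y)) ?oppr0 // => i iA; apply: sy.
  apply: contra n12 => /and3P[_ h1 h2].
  by rewrite (hasD1 h1) (hasD1 h2).
have X3 A : ~~ has 3 A -> X A <> 0 -> R1 A.
  move=> n3; rewrite /X /cadd /copp.
  have nz z : k z = 3%N -> z \notin A by move=> kz; apply: contra n3 => zA; apply/hasP; exists z.
  have -> : u A = 0.
    rewrite /u /cadd sa ?sb ?(negbTE (nz _ _)) ?andbF // !addr0 /c0; case: eqP => // e.
    by case/negP: (nz z1 kz1); rewrite e inE kz1.
  rewrite add0r => h; apply: contrapT => /negP nR; apply: h.
  by rewrite sy ?oppr0.
(* The part of [X] without coordinates involves [a] and [b] simultaneously: it is the Mayer-Vietoris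
   class on the complement of the two cones. *)
pose eta := cut (fun A => ~~ has 3 A) X.
have reta : regular iota f eta by apply: regular_cut.
have heta : pure m eta by apply: pure_cut.
have seta : supp R1 eta.
  move=> A nR; rewrite /eta /cut; case: ifP => // n3; apply: contrapT => /(X3 A n3).
  exact/negP.
have Deta A : ~~ has 0 A -> ~~ has 3 A -> cD eta A = 0.
  move=> n0 n3; rewrite -[RHS](DX A n0); apply: eq_cD => i iA; rewrite /eta /cut.
  by rewrite (contra _ n3) //; apply: hasD1.
have seta1 : supp (has 1) eta by apply: suppW seta _ => A /and3P[].
have seta2 : supp (has 2) eta by apply: suppW seta _ => A /and3P[].
(* Extension of [eta] to sets containing equations of class 0: [rad01] gives [lam], and its part
   without class 1 gets a primitive [mu] from [rad02]. *)
pose R2 A := has 0 A && (has 2 A && ~~ has 3 A).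
have [||A j|A|||||lam [rlam slam hlam Dlam]] :=
    @region_exact S K iota I f R2 (P 1) m.+1 (cut R2 (cD eta)).
- exact: P1n.
- exact: convexI (convexU (@up_has 0)) (convexI (convexU (@up_has 2)) (convexN (@up_has 3))).
- by rewrite !inE => /eqP kj; rewrite /R2 !hasU kj.
- by case/and3P=> h0 _ _; apply: rad_has h0 => // i; rewrite inE => /eqP ->.
- by apply: regular_cut; apply: regular_cD.
- exact: supp_cut.
- by apply: pure_cut; apply: pure_cD.
- move=> A R2A; have /and3P[h0 h2 n3] := R2A.
  apply: cD_cutD => // i iA; rewrite /R2.
  have n3' : ~~ has 3 (A :\ i) by apply: contra n3; apply: hasD1.
  rewrite n3' andbT negb_and => /orP[n0|n2]; first exact: Deta.
  exact: (suppU (@up_has 2) seta2).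
have hlam' : pure m lam by move=> A /hlam[].
pose R3 A := has 0 A && (~~ has 1 A && ~~ has 3 A).
pose lam0 := cut (fun A => ~~ has 1 A) lam.
have slam2 : supp (has 2) lam by apply: suppW slam _ => A /and3P[].
have slam0 : supp (has 0) lam by apply: suppW slam _ => A /and3P[].
have [||A j|A|||||mu [rmu smu hmu Dmu]] := @region_exact S K iota I f R3 (P 2) m lam0.
- exact: P2n.
- exact: convexI (convexU (@up_has 0)) (convexI (convexN (@up_has 1)) (convexN (@up_has 3))).
- by rewrite !inE => /eqP kj; rewrite /R3 !hasU kj.
- by case/and3P=> h0 _ _; apply: rad_has h0 => // i; rewrite inE => /eqP ->.
- exact: regular_cut.
- move=> A nR; rewrite /lam0 /cut; case: ifP => // n1; apply: slam.
  by apply: contra nR => /and3P[h0 _ n3]; rewrite /R3 h0 n1.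
- exact: pure_cut.
- move=> A /and3P[h0 n1 n3].
  have -> : cD lam0 A = cD lam A.
    apply: eq_cD => i iA; rewrite /lam0 /cut.
    by rewrite (contra _ n1) //; apply: hasD1.
  have [h2|n2] := boolP (has 2 A); last exact: (suppU (@up_has 2) slam2).
  rewrite Dlam /R2 ?h0 ?h2 // /cut /R2 h0 h2 n3 /=.
  exact: (suppU (@up_has 1) seta1).
have smu0 : supp (has 0) mu by apply: suppW smu _ => A /and3P[].
(* A component of [mu] avoiding [P 2] would be a set of [m - 1] elements of [P 0]. *)
have smu2 : supp (has 2) mu.
  move=> A n2; apply: contrapT => muA; have := hmu A muA.
  have : R3 A by apply: contrapT => /negP/smu.
  case/and3P=> _ n1 n3.
  have : A \subset P 0.
    apply/subsetP => i iA; rewrite inE; have := kle i.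
    have : k i != 1%N by apply: contra n1 => /eqP ki; apply/hasP; exists i.
    have : k i != 2%N by apply: contra n2 => /eqP ki; apply/hasP; exists i.
    have : k i != 3%N by apply: contra n3 => /eqP ki; apply/hasP; exists i.
    by lia.
  by move/subset_leq_card => le e; move: card03; rewrite -/m -e ltnS ltnNge le.
(* Subtracting the coboundary of [mu] leaves a correction supported on sets that meet all of the
   classes 0, 1 and 2. *)
pose lam1 := cadd lam (copp (cut R2 (cD mu))).
have Dlam1 A : R2 A -> cD lam1 A = cD eta A.
  move=> R2A; have /and3P[h0 h2 n3] := R2A.
  rewrite cD_add Dlam // /cut R2A cD_opp cD_cutD ?oppr0 ?addr0 // => i iA; rewrite /R2.
  have n3' : ~~ has 3 (A :\ i) by apply: contra n3; apply: hasD1.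
  rewrite n3' andbT negb_and => /orP[n0|n2].
    exact: (suppU (@up_has 0) smu0).
  exact: (suppU (@up_has 2) smu2).
have slam1 : supp R2 lam1.
  by move=> A nR; rewrite /lam1 /cadd /copp slam // /cut (negbTE nR) oppr0 addr0.
have slam11 : supp (has 1) lam1.
  move=> A n1; have [R2A|] := boolP (R2 A); last exact: slam1.
  have /and3P[h0 h2 n3] := R2A.
  rewrite /lam1 /cadd /copp /cut R2A Dmu; last by rewrite /R3 h0 n1.
  by rewrite /lam0 /cut n1 addrN.
have slam10 : supp (has 0) lam1 by apply: suppW slam1 _ => A /and3P[].
(* [eta - lam1] is closed on this region and by [rad12] has a primitive there; the part [th] of it
   without class 0 is a primitive of [eta]. *)
pose R4 A := has 1 A && (has 2 A && ~~ has 3 A).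
have [||A j|A|||||kap [rkap skap hkap Dkap]] :=
    @region_exact S K iota I f R4 (P 0) m (cadd eta (copp lam1)).
- exact: P0n.
- exact: convexI (convexU (@up_has 1)) (convexI (convexU (@up_has 2)) (convexN (@up_has 3))).
- by rewrite !inE => /eqP kj; rewrite /R4 !hasU kj.
- case/and3P=> /hasP[i iA ki] /hasP[j jA kj] _; apply: (rad_prod2 _ _ _ (rad12 ki kj)).
  + by apply/eqP => ij; move: kj; rewrite -ij ki.
  + by rewrite !inE iA ki.
  + by rewrite !inE jA kj.
- apply: regular_add => //; apply: regular_opp; apply: regular_add => //.
  by apply: regular_opp; apply: regular_cut; apply: regular_cD.
- move=> A nR; rewrite /cadd /copp.
  have -> : eta A = 0.
    have [h3|n3] := boolP (has 3 A); first by rewrite /eta /cut h3.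
    by apply: seta; apply: contra nR => /and3P[_ h1 h2]; rewrite /R4 h1 h2.
  have [h1|n1] := boolP (has 1 A); last by rewrite slam11 // subr0.
  rewrite slam1 ?subr0 //; apply: contra nR => /and3P[_ h2 n3].
  by rewrite /R4 h1 h2.
- apply: pure_add => //; apply: pure_opp; apply: pure_add => //.
  apply: pure_opp; apply: pure_cut => A /cD_neq0[i iA /hmu <-].
  by rewrite (cardsD1 i) iA.
- move=> A /and3P[h1 h2 n3]; rewrite cD_add cD_opp.
  have [h0|n0] := boolP (has 0 A); first by rewrite Dlam1 ?addrN // /R2 h0 h2.
  by rewrite Deta // (suppU (@up_has 0) slam10) // subr0.
pose th := cut (fun A => ~~ has 0 A) kap.
have rth : regular iota f th by apply: regular_cut.
have hth A : th A <> 0 -> #|A|.+1 = m by rewrite /th /cut; case: ifP => // _; apply: hkap.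
have sth1 : supp (has 1) th.
  move=> A n1; rewrite /th /cut; case: ifP => // _; apply: skap.
  by rewrite /R4 (negbTE n1).
have sth2 : supp (has 2) th.
  move=> A n2; rewrite /th /cut; case: ifP => // _; apply: skap.
  by rewrite /R4 (negbTE n2) andbF.
(* Away from class 0, [Y] is still a cocycle but vanishes on sets without coordinates; its value at
   [P 3] is still [1 / prod z]. *)
pose Y := cadd X (copp (cD th)).
have Y3 A : ~~ has 0 A -> ~~ has 3 A -> Y A = 0.
  move=> n0 n3; rewrite /Y /cadd /copp.
  have -> : X A = eta A by rewrite /eta /cut n3.
  have [h12|] := boolP (has 1 A && has 2 A); last first.
    move=> n12; rewrite seta; last by rewrite /R1 (negbTE n12) andbF.
    move: n12; rewrite negb_and => /orP[n1|n2].
      by rewrite (suppU (@up_has 1) sth1) // subr0.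
    by rewrite (suppU (@up_has 2) sth2) // subr0.
  have /andP[h1 h2] := h12.
  have -> : cD th A = cD kap A.
    apply: eq_cD => i iA; rewrite /th /cut.
    by rewrite (contra _ n0) //; apply: hasD1.
  rewrite Dkap; last by rewrite /R4 h1 h2.
  by rewrite /cadd /copp (slam10 A) // subr0 addrN.
(* Where a coordinate is present, [rad3] makes [Y] a coboundary; its primitive [om] is the required
   cochain. *)
pose R5 A := ~~ has 0 A && has 3 A.
have [||A j|A|||||om [rom som hom Dom]] :=
    @region_exact S K iota I f R5 (P 1 :|: P 2) m (cut R5 Y).
- by rewrite -card_gt0; apply: leq_trans (subset_leq_card (subsetUl _ _)); rewrite card_gt0.
- exact: convexI (convexN (@up_has 0)) (convexU (@up_has 3)).
- by rewrite !inE => /orP[]/eqP kj; rewrite /R5 !hasU kj.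
- by case/andP=> _ h3; apply: rad_has h3 => // i; rewrite !inE => /orP[]/eqP ->.
- by apply: regular_cut; apply: regular_add => //; apply: regular_opp; apply: regular_cD.
- exact: supp_cut.
- apply: pure_cut; apply: pure_add => //; apply: pure_opp => A /cD_neq0[i iA /hth <-].
  by rewrite (cardsD1 i) iA.
- move=> A /andP[n0 h3].
  have -> : cD (cut R5 Y) A = cD Y A.
    apply: eq_cD => i iA; rewrite /cut /R5.
    have n0' : ~~ has 0 (A :\ i) by apply: contra n0; apply: hasD1.
    by rewrite n0' /=; case: ifPn => // n3; rewrite Y3.
  by rewrite cD_add cD_opp cDD DX // subr0.
exists om => //.
have nP j : j != 3%N -> ~~ has j (P 3).
  by move=> j3; apply/hasP => [[l]]; rewrite inE => /eqP -> /esym/eqP; apply/negP.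
rewrite Dom; last first.
  by rewrite /R5 nP //; apply/hasP; exists z1; rewrite ?inE ?kz1.
rewrite /cut /R5 nP //= ifT; last by apply/hasP; exists z1; rewrite ?inE ?kz1.
rewrite /Y /X /u /cadd /copp (suppU (@up_has 1) sth1) ?nP // subr0.
rewrite (sy (P 3)) ?subr0; last by rewrite /R1 (negbTE (nP 1 isT)) andbF.
by rewrite sa1 ?sb2 ?nP // !addr0 /c0 eqxx.
Qed.

End Connectedness.

(** * The Nullstellensatz over an uncountable field *)

Definition uncountable (T : eqType) := forall E : nat -> seq T, exists c, forall d, c \notin E d.

(** If for some [N] the class [E d] has no [N] distinct elements, a finite list exhausts it, and
    countably many such lists cannot cover [T]. *)
Lemma uncountable_pigeonhole (T : eqType) (E : nat -> T -> Prop) :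
  uncountable T -> (forall c, exists d, E d c) ->
  exists d, forall N, exists s : seq T, [/\ uniq s, size s = N & forall c, c \in s -> E d c].
Proof.
move=> uT cov; apply: contrapT => nE.
have /choice[L HL] d : exists L : seq T, forall c, E d c -> c \in L.
  have [N HN] : exists N, ~ exists s : seq T, [/\ uniq s, size s = N & forall c, c \in s -> E d c].
    apply: contrapT => h; apply: nE; exists d => N; apply: contrapT => h'.
    by apply: h; exists N.
  elim: N HN => [|N IH] HN; first by case: HN; exists [::].
  have [[s [us ss Es]]|] := pselect (exists s : seq T,
    [/\ uniq s, size s = N & forall c, c \in s -> E d c]); last exact: IH.
  exists s => c Ec; apply: contrapT => /negP nc; apply: HN; exists (c :: s).
  split; rewrite /= ?nc ?ss // => c'; rewrite inE => /orP[/eqP ->|] //; exact: Es.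
have [c Hc] := uT L; have [d Ed] := cov c.
by have := Hc d; rewrite HL.
Qed.

Lemma interval_avoid (R : realType) (L : seq R) (a b : R) : a < b ->
  exists p : R * R, [/\ a <= p.1, p.1 < p.2, p.2 <= b &
    forall x, p.1 <= x -> x <= p.2 -> x \notin L].
Proof.
elim: L a b => [|c L IH] a b ab; first by exists (a, b).
have [c' [a' [ac aa' a'c c'b]]] : exists c' a', [/\ a <= a', a' < c', c' <= b &
    forall x, a' <= x -> x <= c' -> x != c].
  (* The outer third on the side away from [c] avoids it. *)
  have [ca|ac] := leP c ((a + b) / 2).
    exists b, ((a + 2 * b) / 3); split; try lra.
    by move=> x xa xb; apply/eqP => xc; lra.
  exists ((2 * a + b) / 3), a; split; try lra.
  by move=> x xa xb; apply/eqP => xc; lra.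
have [p [p1 p12 p2 Hp]] := IH _ _ aa'; exists p; split; try lra.
move=> x x1 x2; rewrite inE negb_or Hp // andbT; apply: c'b; lra.
Qed.

(** Cantor's nested intervals: the supremum of the left endpoints lies in every [J d], and [J d.+1]
    avoids [E d]. *)
Lemma uncountable_real (R : realType) : uncountable R.
Proof.
move=> E.
have /choice[st Hst] (q : nat * (R * R)) : exists p : R * R, q.2.1 < q.2.2 ->
    [/\ q.2.1 <= p.1, p.1 < p.2, p.2 <= q.2.2 & forall x, p.1 <= x -> x <= p.2 -> x \notin E q.1].
  have [lt|] := boolP (q.2.1 < q.2.2); last by exists (0, 0).
  by have [p Hp] := interval_avoid (E q.1) lt; exists p.
pose fix J d : R * R := if d is d'.+1 then st (d', J d') else (0, 1).
have Jlt d : (J d).1 < (J d).2.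
  by elim: d => [|d IH] /=; [exact: ltr01 | have [] := Hst (d, J d) IH].
have Jst d := Hst (d, J d) (Jlt d).
have Jmon d e : (d <= e)%N -> (J d).1 <= (J e).1 /\ (J e).2 <= (J d).2.
  elim: e => [|e IH]; first by rewrite leqn0 => /eqP ->.
  rewrite leq_eqVlt => /orP[/eqP -> //|]; rewrite ltnS => /IH[h1 h2].
  by have /= [h3 _ h4 _] := Jst e; split; [apply: le_trans h3 | apply: le_trans h2].
pose U : classical_sets.set R := fun x => exists d, x = (J d).1.
have ubU d : classical_sets.ubound U (J d).2.
  move=> _ [e ->]; have [/Jmon[h _]|/ltnW/Jmon[_ h]] := leqP e d.
    by apply: le_trans h _; apply: ltW.
  by apply: le_trans h; apply: ltW.
have U0 : classical_sets.nonempty U by exists (J 0).1, 0%N.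
have hU : classical_sets.has_sup U by split => //; exists (J 0).2; apply: ubU.
exists (sup U) => d; have /= [_ _ _] := Jst d; apply.
  by apply: sup_upper_bound hU _ _; exists d.+1.
exact: ge_sup U0 (ubU d.+1).
Qed.

Lemma uncountable_complex (R : realType) : uncountable R[i].
Proof.
move=> E; have [x Hx] := uncountable_real (fun d => [seq complex.Re c | c <- E d]).
exists (x%:C)%C => d; apply: contra (Hx d) => h.
by apply/mapP; exists (x%:C)%C.
Qed.

Lemma linear_dependence (F : fieldType) (m b : nat) (N : nat) (g : 'I_N -> {mpoly F[m]}) :
  (#|{: 'X_{1..m < b}}| < N)%N -> (forall j, msize (g j) <= b)%N ->
  exists2 v : 'I_N -> F, exists j, v j != 0 & \sum_j v j *: g j = 0.
Proof.
move=> ltN sg; pose M := \matrix_(j < N, e < #|{: 'X_{1..m < b}}|) (g j)@_(enum_val e : 'X_{1..m}).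
have : kermx M != 0.
  rewrite kermx_eq0 /row_free neq_ltn; apply/orP; left.
  exact: leq_ltn_trans (rank_leq_col M) ltN.
case/rowV0Pn => v /sub_kermxP vM v0; exists (fun j => v 0 j).
  apply: contrapT => h; case/eqP: v0; apply/rowP => j; rewrite mxE.
  by apply: contrapT => /eqP vj; apply: h; exists j.
apply/mpolyP => mo; rewrite mcoeff0 raddf_sum /=.
have [lt|ge] := ltnP (mdeg mo) b; last first.
  apply: big1 => j _; rewrite mcoeffZ (_ : _@_mo = 0) ?mulr0 //.
  by apply: memN_msupp_eq0; apply: msize_mdeg_ge; apply: leq_trans ge.
have := congr1 (fun A : 'rV_ _ => A 0 (enum_rank (BMultinom lt))) vM; rewrite !mxE => e.
by rewrite -[RHS]e; apply: eq_bigr => j _; rewrite mcoeffZ mxE enum_rankK.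
Qed.

Section Nullstellensatz.
Variables (F : closedFieldType) (m : nat).
Local Notation S := {mpoly F[m]}.
Hypothesis uF : uncountable F.

Definition is_ideal (T : S -> Prop) :=
  [/\ T 0, forall p r, T p -> T r -> T (p + r) & forall p r, T r -> T (p * r)].

(** Zorn's lemma; the last clause says that the quotient by [T], localized at [h], is a field. *)
Lemma maximal_ideal_avoiding (T0 : S -> Prop) h : is_ideal T0 -> (forall N, ~ T0 (h ^+ N)) ->
  exists T : S -> Prop, [/\ is_ideal T, forall p, T0 p -> T p, forall N, ~ T (h ^+ N) &
    forall g, ~ T g -> exists N r, T (h ^+ N - r * g)].
Proof.
move=> iT0 nT0.
pose good (A : classical_sets.set S) := 
  [/\ is_ideal A, forall p, T0 p -> A p & forall N, ~ A (h ^+ N)].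
pose P : classical_sets.set (classical_sets.set S) :=
  fun A => A = classical_sets.set0 \/ good A.
have [Fm FP tot|T [[T0e|[iT TT nT]] maxT]] := @classical_sets.Zorn_bigcup _ P.
- have [[A FA gA]|nF] := pselect (exists2 A, Fm A & good A); last first.
    left; apply/classical_sets.seteqP; split=> // p [B FB Bp].
    by case: (FP B FB) => [B0|gB]; [rewrite -B0 | case: nF; exists B].
  have gB B p : Fm B -> B p -> good B.
    by move=> FB Bp; case: (FP B FB) => // B0; rewrite B0 in Bp.
  right; split; [split|by move=> p /(let: And3 _ x _ := gA in x p) Ap; exists A|].
  + by exists A => //; case: gA => [[]].
  + move=> p r [B FB Bp] [B' FB' B'r].
    have [le|le] := tot B B' FB FB'.
      by exists B' => //; have [[_ D _] _ _] := gB _ _ FB' B'r; apply: D => //; apply: le.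
    by exists B => //; have [[_ D _] _ _] := gB _ _ FB Bp; apply: D => //; apply: le.
  + by move=> p r [B FB Br]; exists B => //; have [[_ _ M] _ _] := gB _ _ FB Br; apply: M.
  + by move=> N [B FB BN]; have [_ _ n] := gB _ _ FB BN; apply: (n N).
- exfalso; apply: (maxT T0); last by right; split.
  rewrite T0e; split; first by move=> p [].
  by move=> le; case: iT0 => z _ _; apply: (le _ z).
exists T; split=> // g nTg; apply: contrapT => nh.
have [z D M] := iT.
pose T' : classical_sets.set S := fun p => exists r, T (p - r * g).
have TT' p : T p -> T' p by exists 0; rewrite mul0r subr0.
apply: (maxT T').
  split=> // le; apply: nTg; apply: le; exists 1.
  by rewrite mul1r subrr.
right; split; [split|by move=> p /TT/TT'|].
- exact: TT'.
- move=> p r [a Ta] [b Tb]; exists (a + b); have := D _ _ Ta Tb.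
  by rewrite mulrDl; congr (T _); ring.
- by move=> p r [a Ta]; exists (p * a); have := M p _ Ta; congr (T _); ring.
- by move=> N [r Tr]; apply: nh; exists N, r.
Qed.

(** Let [T] be maximal among the ideals that contain [T0] and no power of [h]. Each coordinate is
    congruent to a constant modulo [T]: otherwise all ['X_i - c] are invertible up to powers of [h],
    and among uncountably many inverses there is a linear relation. So [T] is the ideal of a point;
    [T0] vanishes there, hence [h] does, and [h] lies in [T]. *)
Lemma nullstellensatz (T0 : S -> Prop) h : is_ideal T0 ->
  (forall v, (forall p, T0 p -> p.@[v] = 0) -> h.@[v] = 0) -> exists N, T0 (h ^+ N).
Proof.
move=> iT0 van; apply: contrapT => nT0.
have [|T [[z D M] TT nT maxT]] := maximal_ideal_avoiding iT0 (h := h).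
  by move=> N TN; apply: nT0; exists N.
have TB p r : T p -> T r -> T (p - r).
  by move=> Tp Tr; rewrite -mulN1r; apply: D => //; apply: M.
have TC c : c != 0 -> ~ T c%:A.
  move=> c0 Tc; apply: (nT 0%N); rewrite expr0.
  by have := M (c^-1)%:A _ Tc; rewrite -scalerAl mul1r scalerA mulVf ?scale1r.
have /choice[v Hv] i : exists c : F, T ('X_i - c%:A).
  apply: contrapT => ni.
  have inv c : exists N r, T (h ^+ N - r * ('X_i - c%:A)).
    by apply: maxT => Tc; apply: ni; exists c.
  (* [d] encodes an exponent [N] and a size bound [b]: infinitely many [c] share both, so their
     inverses lie in one space of finite dimension. *)
  pose E d c := exists2 r, (msize r <= (odflt (0, 0) (unpickle d : option (nat * nat))).2)%N &
    T (h ^+ (odflt (0, 0) (unpickle d : option (nat * nat))).1 - r * ('X_i - c%:A)).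
  have [c|d] := uncountable_pigeonhole (E := E) uF.
    have [N [r Tr]] := inv c; exists (pickle (N, msize r)).
    by rewrite /E pickleK /=; exists r.
  rewrite /E; case: (odflt _ _) => N b /= => Hd.
  have [s [us ss Es]] := Hd (#|{: 'X_{1..m < b}}|.+1).
  have /choice[g Hg] (j : 'I_(#|{: 'X_{1..m < b}}|.+1)) : exists r, (msize r <= b)%N /\
      T (h ^+ N - r * ('X_i - (s`_j)%:A)).
    by have [|r r1 r2] := Es s`_j; [rewrite mem_nth ?ss | exists r].
  have [|u [j0 uj0] ug] := @linear_dependence F m b _ g (ltnSn _).
    by move=> j; have [] := Hg j.
  (* The numerator of [\sum_j u j / ('X - s_j)]; it is nonzero at [s_j0] because [u j0 != 0]. *)
  pose pp : {poly F} := \sum_j u j *: \prod_(l | l != j) ('X - (s`_l)%:P).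
  have pp0 : pp != 0.
    apply/eqP => p0; have : pp.[s`_j0] = 0 by rewrite p0 horner0.
    rewrite /pp horner_sum (bigD1 j0) //= [X in _ + X]big1 => [|j jj0]; last first.
      by rewrite hornerZ horner_prod (bigD1 j0) 1?eq_sym //= hornerXsubC subrr mul0r mulr0.
    rewrite addr0 hornerZ horner_prod => /eqP; rewrite mulf_eq0 (negbTE uj0) /=.
    move/prodf_eq0 => [l lj0]; rewrite hornerXsubC subr_eq0 nth_uniq ?ss // => /eqP/val_inj e.
    by rewrite e eqxx in lj0.
  pose ev : {rmorphism {poly F} -> S} := horner_alg ('X_i : S).
  have evX c : ev ('X - c%:P) = 'X_i - c%:A.
    by rewrite rmorphB /= horner_algX horner_algC.
  (* Modulo [T], [g j] acts as [h ^+ N / ('X_i - s_j)], so the relation among the [g j] becomes this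
     membership. *)
  have Tpp : T (h ^+ N * ev pp).
    have -> : h ^+ N * ev pp = \sum_j (u j)%:A *
        ((\prod_(l | l != j) ('X_i - (s`_l)%:A)) * (h ^+ N - g j * ('X_i - (s`_j)%:A))).
      have e j : u j *: \prod_(l | l != j) ('X - (s`_l)%:P) =
          (u j)%:P * \prod_(l | l != j) ('X - (s`_l)%:P) by rewrite mul_polyC.
      rewrite /pp rmorph_sum mulr_sumr /=.
      transitivity (\sum_j ((u j)%:A * ((\prod_(l | l != j) ('X_i - (s`_l)%:A)) * h ^+ N)
          - (u j *: g j) * \prod_(l < #|{: 'X_{1..m < b}}|.+1) ('X_i - (s`_l)%:A))).
        rewrite sumrB -mulr_suml ug mul0r subr0; apply: eq_bigr => j _.
        rewrite e rmorphM /= horner_algC rmorph_prod.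
        rewrite [X in _ * (_ * X)](eq_bigr (fun l : 'I__ => 'X_i - (s`_l)%:A)) => [|l _];
          last exact: evX.
        by ring.
      apply: eq_bigr => j _; rewrite [\prod_l _](bigD1 j) //= -(mul1r (g j)) scalerAl; ring.
    by apply: (big_ind T) => // j _; apply/M/M; have [] := Hg j.
  have [rs Hrs] := closed_field_poly_normal pp.
  have lc : lead_coef pp != 0 by rewrite lead_coef_eq0.
  have {Tpp} : T (h ^+ N * \prod_(c <- rs) ('X_i - c%:A)).
    have := M (lead_coef pp)^-1%:A _ Tpp; congr (T _).
    rewrite {2}Hrs -mul_polyC rmorphM rmorph_prod /= horner_algC.
    rewrite (eq_bigr _ (fun l _ => evX l)) mulrCA; congr (_ * _).
    by rewrite mulrA -scalerAl mul1r scalerA mulVf // scale1r mul1r.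
  (* The linear factors of [pp] are removed one by one, each at the cost of a power of [h], until a
     power of [h] alone lies in [T]. *)
  elim: rs N {Hg Hd Es Hrs} => [|c rs IH] N; first by rewrite big_nil mulr1; apply: nT.
  rewrite big_cons => Tc; have [N' [r Tr]] := inv c.
  apply: (IH (N + N')%N).
  have T1 := M r _ Tc; have T2 := M (h ^+ N * \prod_(c <- rs) ('X_i - c%:A)) _ Tr.
  by have := D _ _ T1 T2; congr (T _); rewrite exprD; ring.
have AM a b : (a * b)%:A = a%:A * b%:A :> S by rewrite -scalerAl mul1r scalerA.
have Tev p : T (p - p.@[v]%:A).
  elim/mpolyind: p => [|c mo p _ _ IH]; first by rewrite meval0 scale0r subr0.
  rewrite mevalD mevalZ scalerDl opprD addrACA; apply/D => //.
  rewrite -scalerA -scalerBr -(mul1r (_ - _)) scalerAl; apply/M.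
  rewrite mpolyXE_id; elim/big_ind: _ => [|p1 p2 T1 T2|i _].
  - by rewrite meval1 scale1r subrr.
  - have := D _ _ (M p2 _ T1) (M (p1.@[v])%:A _ T2); congr (T _).
    by rewrite mevalM AM; ring.
  - elim: (mo i) => [|d IHd]; first by rewrite expr0 meval1 scale1r subrr.
    rewrite exprS; have := D _ _ (M ('X_i ^+ d) _ (Hv i)) (M (v i)%:A _ IHd); congr (T _).
    by rewrite mevalM mevalXU AM; ring.
have hv : h.@[v] = 0.
  apply: van => p /TT Tp; apply: contrapT => /eqP pv; apply: (TC _ pv).
  by have := TB _ _ Tp (Tev p); congr (T _); ring.
by apply: (nT 1%N); have := Tev h; rewrite hv scale0r subr0 expr1.
Qed.

Lemma rad_of_vanishing (I : finType) (f : I -> S) (J : {set I}) h :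
  (forall v, (forall j, j \in J -> (f j).@[v] = 0) -> h.@[v] = 0) -> rad f J h.
Proof.
move=> van; apply: nullstellensatz => [|v Hv]; last first.
  by apply: van => j jJ; apply: Hv; apply: idl_gen.
split=> [|p r [u ->] [w ->]|]; last by move=> p r; apply: idl_mull.
  by exists (fun _ => 0); rewrite big1 // => j _; rewrite mul0r.
by exists (fun j => u j + w j); rewrite -big_split; apply: eq_bigr => j _; rewrite mulrDl.
Qed.

End Nullstellensatz.

(** * Connectedness of cones cut out by few equations *)

(** The monomial with all exponents [N] occurs in no multiple of any ['X_j ^+ N.+1]; this is the
    nonvanishing of top local cohomology at the origin. *)
Lemma prodX_notin_ideal (F : fieldType) (m N : nat) (q : 'I_m -> {mpoly F[m]}) :
  (\prod_j 'X_j) ^+ N <> \sum_j q j * 'X_j ^+ N.+1.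
Proof.
pose mo : 'X_{1..m} := [multinom N | _ < m].
have -> : (\prod_j 'X_j) ^+ N = 'X_[mo] :> {mpoly F[m]}.
  by rewrite mpolyXE_id -prodrXl; apply: eq_bigr => j _; rewrite mnmE.
move/(congr1 (mcoeff mo)); rewrite mcoeffX eqxx raddf_sum big1 /=.
  by move/eqP; rewrite oner_eq0.
move=> j _; apply: memN_msupp_eq0.
rewrite mpolyXn (perm_mem (msuppMX _ _)); apply/mapP => -[mo' _ /mnmP/(_ j)].
by rewrite mnmE mnmDE mulmnE mnm1E eqxx /=; lia.
Qed.

(** Multiplication by the power [N.+1] of the product of the coordinates clears all denominators and
    leads to a membership excluded by [prodX_notin_ideal]. *)
Lemma residue_neq0 (F : fieldType) (m : nat) (K : fieldType)
    (iota : {rmorphism {mpoly F[m]} -> K}) (I : finType) (f : I -> {mpoly F[m]})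
    (e : 'I_m -> I) (P : {set I}) (y : cochain K I) :
  injective iota -> injective e -> P = [set e j | j in 'I_m] -> (forall j, f (e j) = 'X_j) ->
  regular iota f y -> cD y P <> (iota (fset_prod f P))^-1.
Proof.
move=> iinj einj PE fe ry.
have eP j : e j \in P by rewrite PE imset_f.
have [N HN] : exists N, forall j, exists p,
    iota (fset_prod f (P :\ e j)) ^+ N * y (P :\ e j) = iota p.
  have [n_ Hn] := choice (fun j => ry (P :\ e j)).
  exists (\max_j n_ j)%N => j; have [p Hp] := Hn j.
  exists (fset_prod f (P :\ e j) ^+ (\max_j n_ j - n_ j)%N * p).
  by rewrite rmorphM rmorphXn -Hp mulrA -exprD subnK // (leq_bigmax j).
have {HN} [p Hp] := choice HN.
pose sg j : {mpoly F[m]} := (-1) ^+ #|[set l in P | (enum_rank l < enum_rank (e j))%N]|.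
have gE : fset_prod f P = \prod_j 'X_j.
  rewrite /fset_prod PE big_imset /=; last by move=> i j _ _ /einj.
  by apply: eq_bigr => j _; rewrite fe.
have g0 : iota (fset_prod f P) != 0.
  rewrite -(rmorph0 iota) (inj_eq iinj) gE; apply/prodf_neq0 => j _.
  by rewrite -msupp_eq0 msuppX.
move=> /(congr1 (fun u => iota (fset_prod f P) ^+ N.+1 * u)).
rewrite exprSr mulfK // -rmorphXn => e1.
apply: (@prodX_notin_ideal F m N (fun j => sg j * fset_prod f (P :\ e j) * p j)).
rewrite -gE; apply: iinj; rewrite -e1 /cD PE big_imset /=; last by move=> i j _ _ /einj.
rewrite -PE rmorph_sum mulr_sumr; apply: eq_bigr => j _.
have sgE : iota (sg j) = sgn K (e j) P by rewrite /sg rmorphXn rmorphN1.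
rewrite (fset_prodD1 f (eP j)) fe !rmorphM sgE !rmorphXn !rmorphM /= -Hp exprMn !exprS; ring.
Qed.

(* The algebraic form of "a subscheme of projective space cut out by too few equations is
   connected": [V(F)] would split into the closed cones [V(a)] and [V(b)] meeting only in the
   origin, with the [z1]-axis in the first and the [z2]-axis in the second. *)
Theorem connectedness (F : closedFieldType) (m : nat) (IF Ia Ib : finType)
    (fF : IF -> {mpoly F[m]}) (fa : Ia -> {mpoly F[m]}) (fb : Ib -> {mpoly F[m]})
    (z1 z2 : 'I_m) (i0 : IF) (ia : Ia) (ib : Ib) :
  uncountable F -> (#|IF|.+1 < m)%N ->
  (forall v i, (forall j, j != z1 -> v j = 0) -> (fa i).@[v] = 0) ->
  (forall v i, (forall j, j != z2 -> v j = 0) -> (fb i).@[v] = 0) ->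
  (forall v, (forall i, (fa i).@[v] = 0) -> (forall i, (fb i).@[v] = 0) -> forall j, v j = 0) ->
  (forall v i j, (forall l, (fF l).@[v] = 0) -> (fa i).@[v] * (fb j).@[v] = 0) ->
  (forall v l, (forall i, (fa i).@[v] = 0) -> (fF l).@[v] = 0) ->
  (forall v l, (forall i, (fb i).@[v] = 0) -> (fF l).@[v] = 0) -> False.
Proof.
move=> uF ltm va vb vab vF vFa vFb.
pose I : finType := ((IF + Ia) + (Ib + 'I_m))%type.
pose f (i : I) : {mpoly F[m]} := match i with
  | inl (inl l) => fF l | inl (inr l) => fa l | inr (inl l) => fb l | inr (inr l) => 'X_l end.
pose k (i : I) : nat := match i with
  | inl (inl l) => 0 | inl (inr l) => 1 | inr (inl l) => 2 | inr (inr l) => 3 end.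
pose zz j : I := inr (inr j).
pose ff l : I := inl (inl l).
pose P j : {set I} := [set i | k i == j].
have P3E : P 3%N = [set zz j | j in 'I_m].
  apply/setP => i; rewrite inE; apply/eqP/imsetP => [|[j _ ->] //].
  by case: i => [[]|[|j]] //= _; exists j.
have P0E : P 0%N = [set ff l | l in IF].
  apply/setP => i; rewrite inE; apply/eqP/imsetP => [|[j _ ->] //].
  by case: i => [[l|]|[|]] //= _; exists l.
have rv := rad_of_vanishing uF.
have [|||||||||||||y ry] := @connectedness_residue {mpoly F[m]} {fraction {mpoly F[m]}}
    (@tofrac _) I f k (zz z1) (zz z2).
- by [].
- by [].
- by case=> [[]|[]].
- by apply/set0Pn; exists (ff i0); rewrite inE.
- by apply/set0Pn; exists (inl (inr ia)); rewrite inE.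
- by apply/set0Pn; exists (inr (inl ib)); rewrite inE.
- case=> [[]|[]] //= l _; apply: rv => v Hv; apply: va => j jz.
  by have := Hv (zz j); rewrite /= mevalXU; apply; rewrite !inE andbT; apply: contra jz => /eqP[->].
- case=> [[]|[]] //= l _; apply: rv => v Hv; apply: vb => j jz.
  by have := Hv (zz j); rewrite /= mevalXU; apply; rewrite !inE andbT; apply: contra jz => /eqP[->].
- case=> [[]|[]] //= l _; apply: rv => v Hv; rewrite mevalXU; apply: vab => i.
    by apply: (Hv (inl (inr i))); rewrite !inE.
  by apply: (Hv (inr (inl i))); rewrite !inE.
- case=> [[]|[]] //= i [[]|[]] //= j _ _; apply: rv => v Hv; rewrite mevalM; apply: vF => l.
  by apply: (Hv (ff l)); rewrite inE.
- case=> [[]|[]] //= l _; apply: rv => v Hv; apply: vFa => i.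
  by apply: (Hv (inl (inr i))); rewrite inE.
- case=> [[]|[]] //= l _; apply: rv => v Hv; apply: vFb => i.
  by apply: (Hv (inr (inl i))); rewrite inE.
- rewrite -/(P 0%N) -/(P 3%N) P0E P3E !card_imset ?card_ord //.
    by move=> ? ? [].
  by move=> ? ? [].
apply: (residue_neq0 (e := zz) _ _ P3E _ ry) => //.
  by move=> p r /eqP; rewrite tofrac_eq => /eqP.
by move=> ? ? [].
Qed.

(** * Lower bounds *)

Lemma prim_root_exists (F : numClosedFieldType) n : (0 < n)%N ->
  exists z : F, n.-primitive_root z.
Proof.
move=> n0; have [rs e] := closed_field_poly_normal ('X^n - 1 : {poly F}).
move: e; rewrite lead_coefXnsubC // scale1r => e.
suff /hasP[z _ zP] : has n.-primitive_root rs by exists z.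
apply: has_prim_root => //.
- by apply/allP => z; rewrite -root_prod_XsubC -e.
- by rewrite -separable_prod_XsubC -e separable_Xn_sub_1 // pnatr_eq0 -lt0n.
- by rewrite -ltnS -(size_prod_XsubC rs id) -e size_XnsubC.
Qed.

Lemma meval_comp_mktuple (F : comNzRingType) (n m : nat) (p : {mpoly F[n]})
    (xs : 'I_n -> {mpoly F[m]}) (v : 'I_m -> F) :
  (p \mPo [tuple xs j | j < n]).@[v] = p.@[fun j => (xs j).@[v]].
Proof. by rewrite comp_mpoly_meval; apply: meval_eq => j; rewrite tnth_mktuple. Qed.

Lemma split_factor (K : fieldType) (k : nat) (s t : K) : s != t -> s ^+ k = t ^+ k ->
  \sum_(i < k) s ^+ (k.-1 - i) * t ^+ i = 0.
Proof.
move=> st /eqP; rewrite -subr_eq0 subrXX mulf_eq0 subr_eq0 (negbTE st) /=.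
by move/eqP.
Qed.

(** There are [2n + 2] variables and [N.+1 + (n.+1 - #|T|)] equations, so [N.+1 < n + #|T|] is
    exactly the inequality that [connectedness] asks for. *)
Theorem separating_sections_bound (C : numClosedFieldType) (n : nat) (q : 'I_n.+1 -> nat)
    (T : {set 'I_n.+1}) (del kap N : nat) (f : 'I_N.+1 -> {mpoly C[n.+1]}) :
  uncountable C -> (forall i, 0 < q i)%N -> q ord0 = 1%N -> ord0 \in T ->
  (forall j, j \in T -> q j %| del)%N -> (0 < del)%N -> (1 < kap)%N ->
  (forall k l x, (f k).@[fun i => l ^+ q i * x i] = l ^+ (del * kap) * (f k).@[x]) ->
  (forall x y, (forall j, j \notin T -> x j = 0) -> (forall k, (f k).@[x] = (f k).@[y]) ->
    exists2 l : C, l ^+ (del * kap) = 1 & forall i, y i = l ^+ q i * x i) ->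
  (n + #|T| <= N.+1)%N.
Proof.
move=> uC q_gt0 q0 T0 qT del0 kap1 hom inj; rewrite leqNgt; apply/negP => ltN.
have M0 : (0 < del * kap)%N by rewrite muln_gt0 del0 (ltn_trans _ kap1).
have [lam lamP] := prim_root_exists C M0.
have lam1 : lam ^+ (del * kap) = 1 by apply: prim_expr_order.
have lamd : lam ^+ del != 1.
  by rewrite -(prim_order_dvd lamP) gtnNdvd // ltn_Pmulr.
have lam_n1 : lam != 1 by apply: contraNneq lamd => ->; rewrite expr1n.
pose m := (n.+1 + n.+1)%N.
pose u0 : 'I_m := lshift n.+1 ord0.
pose v0 : 'I_m := rshift n.+1 ord0.
(* Coordinates are changed at index 0 only: the [u0]-axis then lies in the graph of [l = 1] and, as
   [q ord0 = 1], the [v0]-axis in that of [l = lam]. *)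
pose xs (j : 'I_n.+1) : {mpoly C[m]} := if j == ord0 then 'X_u0 + 'X_v0 else 'X_(lshift n.+1 j).
pose ys (j : 'I_n.+1) : {mpoly C[m]} :=
  if j == ord0 then 'X_u0 + lam *: 'X_v0 else 'X_(rshift n.+1 j).
pose xv (v : 'I_m -> C) (j : 'I_n.+1) : C := (xs j).@[v].
pose yv (v : 'I_m -> C) (j : 'I_n.+1) : C := (ys j).@[v].
pose IF : finType := ('I_N.+1 + {j | j \notin T})%type.
pose fF (l : IF) : {mpoly C[m]} := match l with
  | inl l => (f l \mPo [tuple xs j | j < n.+1]) - (f l \mPo [tuple ys j | j < n.+1])
  (* These equations set the coordinates of [x] outside [T] to zero. *)
  | inr j => xs (val j) end.
(* On the graph of [l] the [ex j]-th powers differ by the factor [l ^+ del]. [fa] asks that they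
   agree; [fb] is the cofactor of their difference in the difference of their [kap]-th powers. *)
pose ex j := (del %/ q j)%N.
pose fa (l : 'I_n.+1 + IF) : {mpoly C[m]} := match l with
  | inl j => if j \in T then xs j ^+ ex j - ys j ^+ ex j else 0
  | inr l => fF l end.
pose fb (l : 'I_n.+1 + IF) : {mpoly C[m]} := match l with
  | inl j => if j \in T then
      \sum_(i < kap) (xs j ^+ ex j) ^+ (kap.-1 - i) * (ys j ^+ ex j) ^+ i else 0
  | inr l => fF l end.
have ex_gt0 j : j \in T -> (0 < ex j)%N.
  by move=> jT; rewrite divn_gt0 // dvdn_leq // qT.
have qex j : j \in T -> (q j * ex j = del)%N by move=> jT; rewrite mulnC divnK ?qT.
have fFl v l : (fF (inl l)).@[v] = (f l).@[xv v] - (f l).@[yv v].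
  by rewrite [LHS]mevalB !meval_comp_mktuple.
have faj v j : j \in T -> (fa (inl j)).@[v] = xv v j ^+ ex j - yv v j ^+ ex j.
  by move=> jT; rewrite /fa jT mevalB !rmorphXn.
have fbj v j : j \in T -> (fb (inl j)).@[v] =
    \sum_(i < kap) (xv v j ^+ ex j) ^+ (kap.-1 - i) * (yv v j ^+ ex j) ^+ i.
  move=> jT; rewrite /fb jT rmorph_sum; apply: eq_bigr => i _.
  by rewrite /= mevalM !rmorphXn.
have fan v j : j \notin T -> (fa (inl j)).@[v] = 0 by move=> /negbTE jT; rewrite /fa jT meval0.
have fbn v j : j \notin T -> (fb (inl j)).@[v] = 0 by move=> /negbTE jT; rewrite /fb jT meval0.
have powq l v j : j \in T -> (forall i, yv v i = l ^+ q i * xv v i) ->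
    yv v j ^+ ex j = l ^+ del * xv v j ^+ ex j.
  by move=> jT ->; rewrite exprMn -exprM qex.
have a0 l v j : l ^+ del = 1 -> (forall i, yv v i = l ^+ q i * xv v i) ->
    (fa (inl j)).@[v] = 0.
  move=> l1 yl; have [jT|jT] := boolP (j \in T); last exact: fan.
  by rewrite faj // (powq l) // l1 mul1r subrr.
have b0 l v j : l ^+ del != 1 -> l ^+ (del * kap) = 1 ->
    (forall i, yv v i = l ^+ q i * xv v i) -> (fb (inl j)).@[v] = 0.
  move=> ld l1 yl; have [jT|jT] := boolP (j \in T); last exact: fbn.
  rewrite fbj // (powq l) //; set s := _ ^+ ex j.
  have [s0|s0] := eqVneq s 0.
    rewrite s0 mulr0 big1 // => i _; have [i0|i0] := eqVneq (i : nat) 0%N; last first.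
      by rewrite [0 ^+ i]expr0n (negbTE i0) mulr0.
    by rewrite i0 subn0 expr0n (_ : (kap.-1 == 0%N) = false) ?mul0r //; lia.
  apply: split_factor; last by rewrite exprMn -[(l ^+ del) ^+ kap]exprM l1 mul1r.
  by apply: contra ld => /eqP e; apply/eqP; apply: (mulIf s0); rewrite mul1r -e.
have T0' (j : {j | j \notin T}) : val j != ord0 by apply: contraNneq (valP j) => ->.
have vz v : (forall j, xv v j = 0) -> (forall j, yv v j = 0) -> forall j, v j = 0.
  move=> x0 y0.
  have := x0 ord0; have := y0 ord0; rewrite /xv /yv /xs /ys eqxx !mevalD mevalZ !mevalXU.
  move=> ey ex0; have : (lam - 1) * v v0 = (v u0 + lam * v v0) - (v u0 + v v0) by ring.
  rewrite ey ex0 subrr => /eqP; rewrite mulf_eq0 subr_eq0 (negbTE lam_n1) /= => /eqP vv0.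
  have vu0 : v u0 = 0 by rewrite -ex0 vv0 addr0.
  move=> j; case: (splitP j) => [i ji|i ji].
    have -> : j = lshift n.+1 i by apply: val_inj.
    by have := x0 i; rewrite /xv /xs; case: eqP => [->|_]; rewrite ?mevalXU.
  have -> : j = rshift n.+1 i by apply: val_inj.
  by have := y0 i; rewrite /yv /ys; case: eqP => [->|_]; rewrite ?mevalXU.
have axis v (z : 'I_m) (l : C) : (z, l) \in [:: (u0, 1); (v0, lam)] ->
    (forall j, j != z -> v j = 0) ->
    (forall j, j != ord0 -> xv v j = 0) /\ (forall i, yv v i = l ^+ q i * xv v i).
  move=> zl vz'.
  have nz j : j != ord0 -> lshift n.+1 j != z /\ rshift n.+1 j != z.
    move=> j0; case/orP: zl => [/eqP[-> _]|/orP[/eqP[-> _]|//]].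
      by rewrite /u0 (inj_eq (@lshift_inj _ _)) j0 eq_sym eq_lrshift.
    by rewrite /v0 (inj_eq (@rshift_inj _ _)) j0 eq_lrshift.
  have x0 j : j != ord0 -> xv v j = 0.
    by move=> j0; rewrite /xv /xs (negbTE j0) mevalXU vz' //; case: (nz j j0).
  split=> // j; have [->|j0] := eqVneq j ord0; last first.
    by rewrite x0 // mulr0 /yv /ys (negbTE j0) mevalXU vz' //; case: (nz j j0).
  rewrite q0 expr1 /xv /yv /xs /ys eqxx !mevalD mevalZ !mevalXU.
  have uv : u0 != v0 by rewrite /u0 /v0 eq_lrshift.
  case/orP: zl => [/eqP[e ->]|/orP[/eqP[e ->]|//]].
    by rewrite (vz' v0) ?e 1?eq_sym // mulr0 mul1r addr0.
  by rewrite (vz' u0) ?e // !add0r.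
have F0 v l : l ^+ (del * kap) = 1 -> (forall j, j != ord0 -> xv v j = 0) ->
    (forall i, yv v i = l ^+ q i * xv v i) -> forall k, (fF k).@[v] = 0.
  move=> l1 x0 yl [k|j]; last by apply: x0; apply: T0'.
  by rewrite fFl (meval_eq _ yl) hom l1 mul1r subrr.
have sol v : (forall k, (fF k).@[v] = 0) -> exists2 l : C, l ^+ (del * kap) = 1 &
    forall i, yv v i = l ^+ q i * xv v i.
  move=> Fv; apply: inj => [j jT|k]; first exact: (Fv (inr (exist _ j jT))).
  by apply/eqP; rewrite -subr_eq0 -fFl Fv.
apply: (@connectedness C m IF ('I_n.+1 + IF)%type ('I_n.+1 + IF)%type fF fa fb u0 v0
  (inl ord0) (inl ord0) (inl ord0)).
- exact: uC.
- rewrite card_sum card_ord card_sig /m.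
  have := cardC (mem T); rewrite card_ord.
  have -> : #|[predC (mem T)]| = #|[pred j | j \notin T]| by apply: eq_card.
  move: ltN; have -> : #|mem T| = #|T| by [].
  by move: #|T| #|_|; lia.
- move=> v i /(axis v u0 1)[]; rewrite ?inE ?eqxx // => x0 y1.
  case: i => [j|k]; first by apply: (a0 1) y1; rewrite expr1n.
  by apply: (F0 v 1) => //; rewrite expr1n.
- move=> v i /(axis v v0 lam)[]; rewrite ?inE ?eqxx ?orbT // => x0 y1.
  by case: i => [j|k]; [apply: (b0 lam) y1 | apply: (F0 v lam)].
(* On both cones the two powers agree, so [fb] becomes [kap] times the power [kap.-1] of one of
   them, which therefore vanishes. *)
- move=> v va vb.
  have x0 j : xv v j = 0.
    have [jT|jT] := boolP (j \in T); last first.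
      exact: (va (inr (inr (exist _ j jT)))).
    have := va (inl j); rewrite faj // => /eqP; rewrite subr_eq0 => /eqP e.
    have := vb (inl j); rewrite fbj // -e.
    under eq_bigr => i _ do rewrite -exprD subnK -1?ltnS ?(ltn_predK kap1) //.
    rewrite sumr_const card_ord => /eqP; rewrite mulrn_eq0 => /orP[/eqP k0|].
      by rewrite k0 in kap1.
    by rewrite expf_eq0 => /andP[_]; rewrite expf_eq0 => /andP[_ /eqP].
  apply: vz => // j; have [l _ ->] := sol v (fun k => va (inr k)).
  by rewrite x0 mulr0.
- move=> v i j Fv; have [l l1 yl] := sol v Fv.
  case: i => [i|i]; last by rewrite [X in X * _]Fv mul0r.
  case: j => [j|j]; last by rewrite [X in _ * X]Fv mulr0.
  have [ld|ld] := eqVneq (l ^+ del) 1; first by rewrite (a0 l) ?mul0r.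
  by rewrite (b0 l v j) ?mulr0.
- by move=> v l va; apply: (va (inr l)).
- by move=> v l va; apply: (va (inr l)).
Qed.

Section LowerBound.
Variables (R : realType) (n : nat) (q : 'I_n.+1 -> nat).
Local Notation C := (R[i]).
Hypothesis q_gt0 : forall i, (0 < q i)%N.

Lemma whomog_eval (M : nat) (p : {mpoly C[n.+1]}) (l : C) x :
  whomog q M%:Z p -> p.@[fun i => l ^+ q i * x i] = l ^+ M * p.@[x].
Proof.
move=> hp; rewrite !mevalE mulr_sumr; apply: eq_big_seq => mo /hp [<-].
rewrite mulrCA; congr (_ * _); rewrite /wdeg -prodrXr -big_split; apply: eq_bigr => i _ /=.
by rewrite exprMn -exprM.
Qed.

Lemma whomog_eval0 (M : nat) (p : {mpoly C[n.+1]}) x :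
  (0 < M)%N -> whomog q M%:Z p -> (forall i, x i = 0) -> p.@[x] = 0.
Proof.
move=> M0 hp x0; have := whomog_eval 0 x hp; rewrite expr0n gtn_eqF // mul0r => <-.
by apply: meval_eq => i; rewrite x0 mulr0.
Qed.

(** Injectivity on the affine cone, origin included: with equal values, a section nonzero at [x]
    forces [l ^+ M = 1]. *)
Lemma proportional_sections M N (f : 'I_N.+1 -> {mpoly C[n.+1]}) x y :
  (0 < M)%N -> inj_morphism q M%:Z f -> (forall l, (f l).@[x] = (f l).@[y]) ->
  exists2 l : C, l ^+ M = 1 & forall i, y i = l ^+ q i * x i.
Proof.
move=> M0 [hf nz inj] exy.
have z0 w : ~ nonzero_pt w -> forall i, w i = 0.
  by move=> nw i; apply: contrapT => /eqP wi; apply: nw; exists i.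
have zf w : (forall l, (f l).@[w] = 0) -> forall i, w i = 0.
  by move=> fw; apply: z0 => /nz[j]; rewrite fw eqxx.
have [nx|/z0 x0] := pselect (nonzero_pt x); last first.
  exists 1; rewrite ?expr1n // => i; rewrite x0 mulr0; apply: zf => l.
  by rewrite -exy; apply: whomog_eval0 (hf l) x0.
have ny : nonzero_pt y.
  apply: contrapT => /z0 y0; have [j] := nz x nx.
  by rewrite exy (whomog_eval0 M0 (hf j) y0) eqxx.
have [|l l0 yl] := inj x y nx ny.
  by exists 1 => [|j]; rewrite ?oner_eq0 // mul1r exy.
exists l => //; have [j fj] := nz x nx.
have := whomog_eval l x (hf j); rewrite -(meval_eq _ yl) -exy -{1}[_.@[x]]mul1r.
by move/(mulIf fj).
Qed.

Theorem sections_lower_bound (T : {set 'I_n.+1}) (del kap N : nat)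
    (f : 'I_N.+1 -> {mpoly C[n.+1]}) :
  q ord0 = 1%N -> ord0 \in T -> (forall j, j \in T -> q j %| del)%N ->
  (0 < del)%N -> (1 < kap)%N -> inj_morphism q (del * kap)%:Z f -> (n + #|T| <= N.+1)%N.
Proof.
move=> q0 T0 qT del0 kap1 hf.
have M0 : (0 < del * kap)%N by rewrite muln_gt0 del0 (ltn_trans _ kap1).
apply: (separating_sections_bound (@uncountable_complex R) q_gt0 q0 T0 qT del0 kap1) =>
    [k l x|x y _].
  by apply: whomog_eval; have [] := hf.
exact: proportional_sections.
Qed.

(* Only points of the [x_0]-axis have to be separated, so the sections may be composed with
   squaring, which makes their degree at least [2]. *)
Lemma sections_dim_bound (M N : nat) (f : 'I_N.+1 -> {mpoly C[n.+1]}) :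
  q ord0 = 1%N -> (0 < M)%N -> inj_morphism q M%:Z f -> (n <= N)%N.
Proof.
move=> q0 M0 hf; rewrite -ltnS -addn1 -(cards1 (ord0 : 'I_n.+1)).
pose g k : {mpoly C[n.+1]} := f k \mPo [tuple 'X_j ^+ 2 | j < n.+1].
have gE k x : (g k).@[x] = (f k).@[fun j => x j ^+ 2].
  by rewrite meval_comp_mktuple; apply: meval_eq => j; rewrite rmorphXn /= mevalXU.
apply: (@separating_sections_bound C n q [set ord0] 1 (2 * M) N g) => //.
- exact: uncountable_complex.
- by rewrite inE.
- by move=> j; rewrite inE => /eqP ->; rewrite q0.
- by lia.
- move=> k l x; rewrite !gE mul1n exprM; have [hom _ _] := hf.
  rewrite -(whomog_eval (l ^+ 2) _ (hom k)); apply: meval_eq => i.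
  by rewrite exprMn -!exprM mulnC.
move=> x y x0 exy; rewrite mul1n.
have [|l l1 yl] := @proportional_sections M N f (fun j => x j ^+ 2) (fun j => y j ^+ 2) M0 hf.
  by move=> k; rewrite -!gE.
have y0 j : j != ord0 -> y j = 0.
  move=> j0; apply/eqP; rewrite -sqrf_eq0 yl x0 ?inE // expr0n mulr0 //.
have [x00|x00] := eqVneq (x ord0) 0.
  exists 1; rewrite ?expr1n // => j; have [->|j0] := eqVneq j ord0; last first.
    by rewrite y0 // (x0 j) ?inE // mulr0.
  by rewrite x00 mulr0; apply/eqP; rewrite -sqrf_eq0 yl x00 expr0n mulr0.
(* The scalar [l] relates only the squares; on the axis the ratio itself serves, as its square is
   [l]. *)
exists (y ord0 / x ord0).
  by rewrite exprM expr_div_n yl q0 expr1 mulfK ?expf_neq0.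
move=> j; have [->|j0] := eqVneq j ord0; first by rewrite q0 expr1 divfK.
by rewrite y0 // (x0 j) ?inE // mulr0.
Qed.

End LowerBound.

(** * Homogeneity, separation and bases *)

Lemma chinese_remainder_seq (T : eqType) (a e : T -> nat) (s : seq T) :
  uniq s -> (forall i j, i \in s -> j \in s -> i != j -> coprime (a i) (a j)) ->
  exists z, forall i, i \in s -> z = e i %[mod a i].
Proof.
elim: s => [|i s IH] /=; first by exists 0%N.
move=> /andP[ni us] cop.
have [j l js ls|z Hz] := IH us; first by apply: cop; rewrite inE ?js ?ls orbT.
have ci : coprime (a i) (\prod_(j <- s) a j).
  rewrite big_seq; elim/big_ind: _ => [|x y cx cy|j js]; first exact: coprimen1.
    by rewrite coprimeMr cx.
  apply: cop; rewrite ?inE ?eqxx ?js ?orbT //.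
  by apply: contraNneq ni => ->.
exists (chinese (a i) (\prod_(j <- s) a j) (e i) z) => j.
rewrite inE => /orP[/eqP ->|js]; first exact: chinese_modl.
have dj : (a j %| \prod_(j <- s) a j)%N by rewrite (big_rem j) //= dvdn_mulr.
by rewrite -Hz // -[LHS](modn_dvdm _ dj) chinese_modr // modn_dvdm.
Qed.

Section Homogeneity.
Variables (R : realType) (n : nat) (q : 'I_n.+1 -> nat).
Local Notation C := (R[i]).
Implicit Types p r : {mpoly C[n.+1]}.

Lemma wdegD m1 m2 : wdeg q (m1 + m2)%MM = (wdeg q m1 + wdeg q m2)%N.
Proof. by rewrite /wdeg -big_split; apply: eq_bigr => i _; rewrite mnmDE mulnDr. Qed.

Lemma whomogM (a b : nat) p r :
  whomog q a%:Z p -> whomog q b%:Z r -> whomog q (a + b)%N%:Z (p * r).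
Proof.
move=> hp hr mo /msuppM_le /allpairsP[[m1 m2] /= [/hp[e1] /hr[e2] ->]].
by rewrite wdegD e1 e2.
Qed.

Lemma whomogXU i : whomog q (q i)%:Z ('X_i : {mpoly C[n.+1]}).
Proof.
move=> mo; rewrite msuppX inE => /eqP ->; congr Posz; rewrite /wdeg (bigD1 i) //=.
by rewrite mnm1E eqxx muln1 big1 ?addn0 // => j ji; rewrite mnm1E eq_sym (negbTE ji) muln0.
Qed.

Lemma whomog1 : whomog q 0 (1 : {mpoly C[n.+1]}).
Proof.
move=> mo; rewrite msupp1 inE => /eqP ->; rewrite /wdeg big1 // => i _.
by rewrite mnm0E muln0.
Qed.

Lemma whomogX (a e : nat) p : whomog q a%:Z p -> whomog q (a * e)%N%:Z (p ^+ e).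
Proof.
move=> hp; elim: e => [|e IH]; first by rewrite muln0 expr0; apply: whomog1.
by rewrite exprS mulnS; apply: whomogM.
Qed.

Lemma whomogD M p r : whomog q M p -> whomog q M r -> whomog q M (p + r).
Proof. by move=> hp hr mo /msuppD_le; rewrite mem_cat => /orP[/hp|/hr]. Qed.

Lemma whomog_sum (I : Type) (s : seq I) (Q : pred I) M (F : I -> {mpoly C[n.+1]}) :
  (forall i, Q i -> whomog q M (F i)) -> whomog q M (\sum_(i <- s | Q i) F i).
Proof.
move=> h; elim/big_ind: _ => // [|p r]; last exact: whomogD.
by move=> mo; rewrite msupp0.
Qed.

(** A factor [mu] between the value vectors is absorbed by acting with an [M]-th root of it, and a
    common zero would not be separated from the origin. *)
Lemma inj_morphism_of_separating (M N : nat) (f : 'I_N.+1 -> {mpoly C[n.+1]}) :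
  (0 < M)%N -> (forall j, whomog q M%:Z (f j)) ->
  (forall x y, (forall j, (f j).@[x] = (f j).@[y]) -> wequiv q x y) ->
  inj_morphism q M%:Z f.
Proof.
move=> M0 hf sep; split=> // [x [i xi]|x y _ _ [mu mu0 e]].
  apply: contrapT => nz; have [|l l0 /(_ i)/esym/eqP] := sep x (fun _ => 0).
    move=> j; rewrite [RHS](whomog_eval0 M0 (hf j)) //.
    by apply: contrapT => /eqP fj; apply: nz; exists j.
  by rewrite mulf_eq0 expf_eq0 (negbTE l0) andbF (negbTE xi).
pose nu := M.-root mu; have nuM : nu ^+ M = mu by apply: rootCK.
have nu0 : nu != 0 by apply: contraNneq mu0 => n0; rewrite -nuM n0 expr0n gtn_eqF.
have [|l l0 yl] := sep (fun i => nu ^+ q i * x i) y.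
  by move=> j; rewrite (whomog_eval _ _ (hf j)) nuM e.
by exists (l * nu) => [|i]; rewrite ?mulf_neq0 // yl mulrA exprMn.
Qed.

Lemma inj_morphism_attained (M : nat) N (f : 'I_N.+1 -> {mpoly C[n.+1]}) :
  inj_morphism q M%:Z f -> exists2 N', (N' <= N)%N & injdim_attained R q M%:Z N'.
Proof.
elim: N f => [|N IH] f hf; have [li|] := pselect (lin_indep f).
- by exists 0%N => //; exists f.
- move=> nli; exfalso; apply: nli => c; rewrite big_ord1 => c0 j.
  rewrite (ord1 j); apply: contrapT => /eqP cj; have [_ nz _] := hf.
  have [|l] := nz (fun _ => 1); first by exists ord0; apply: oner_neq0.
  rewrite (ord1 l); move/eqP: c0; rewrite mscalerI (negbTE cj) /= => /eqP ->.
  by rewrite meval0 eqxx.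
- by exists N.+1 => //; exists f.
move=> nli.
have [c [sc [j0 cj0]]] : exists c : 'I_N.+2 -> C, \sum_j c j *: f j = 0 /\ exists j, c j != 0.
  apply: contrapT => h; apply: nli => c sc j; apply: contrapT => /eqP cj; apply: h.
  by exists c; split => //; exists j.
have fE x : (f j0).@[x] = - (c j0)^-1 * \sum_(j < N.+1) c (lift j0 j) * (f (lift j0 j)).@[x].
  have := congr1 (meval x) sc; rewrite meval0 raddf_sum /= (bigD1_ord j0) //=.
  rewrite mevalZ => /eqP; rewrite addr_eq0 => /eqP e.
  apply: (mulfI cj0); rewrite e mulrA mulrN mulfV // mulN1r.
  by congr (- _); apply: eq_bigr => j _; rewrite mevalZ.
have lf (P : 'I_N.+2 -> Prop) : P j0 -> (forall j, P (lift j0 j)) -> forall j, P j.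
  by move=> P0 Pl j; case: (unliftP j0 j) => [k|] ->.
have [|N' leN att] := IH (fun j => f (lift j0 j)); last by exists N' => //; apply: leqW.
have [hom nz inj] := hf; split=> [j|x nx|x y nx ny [mu mu0 e]]; first exact: hom.
- apply: contrapT => h; have [j] := nz x nx; apply/negP; rewrite negbK; move: j.
  have h' j : (f (lift j0 j)).@[x] = 0 by apply: contrapT => /eqP fj; apply: h; exists j.
  apply: lf => [|j]; last by rewrite h'.
  by rewrite fE big1 ?mulr0 // => j _; rewrite h' mulr0.
- apply: inj => //; exists mu => //; apply: lf => //.
  rewrite !fE mulrCA; congr (_ * _); rewrite mulr_sumr; apply: eq_bigr => j _.
  by rewrite e mulrCA.
Qed.

Lemma injdim_eq (M : nat) N (f : 'I_N.+1 -> {mpoly C[n.+1]}) :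
  inj_morphism q M%:Z f -> (forall N' (g : 'I_N'.+1 -> {mpoly C[n.+1]}),
    inj_morphism q M%:Z g -> (N <= N')%N) -> injdim R q M%:Z = Some N.
Proof.
move=> hf lb; have [N' leN att] := inj_morphism_attained hf.
have NN' : N' = N.
  by apply/eqP; rewrite eqn_leq leN /=; case: att => g [_ hg]; apply: lb hg.
rewrite NN' in att; rewrite /injdim; case: pselect => [h|[]]; last by exists N.
congr Some; case: ex_minnP => K /asboolP [g [_ hg]] /(_ N) minK.
by apply/eqP; rewrite eqn_leq (lb _ _ hg) andbT; apply: minK; apply/asboolP.
Qed.

End Homogeneity.

(** * The maps phi1 and phik *)

Section Embeddings.
Variables (R : realType) (n : nat) (q : 'I_n.+1 -> nat).
Local Notation C := (R[i]).
Local Notation d := (dlcm q).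
Local Notation a := (aa q).
Local Notation b := (bb q).
Hypothesis n_gt0 : (1 <= n)%N.
Hypothesis q_gt0 : forall i, (0 < q i)%N.
Hypothesis q0 : q ord0 = 1%N.
Hypothesis lcm3 : forall i j k : 'I_n.+1, i != j -> j != k -> i != k ->
  lcmn (lcmn (q i) (q j)) (q k) = d.
Implicit Types (x y : 'I_n.+1 -> C) (i j : 'I_n.+1).

Lemma weight_dvd i : (q i %| d)%N.
Proof.
have [i0|i0] := posnP i; last exact: (biglcmn_sup i).
by have -> : i = ord0 by [apply: val_inj]; rewrite q0 dvd1n.
Qed.

Lemma dlcm_gt0 : (0 < d)%N.
Proof. by rewrite /dlcm; elim/big_ind: _ => // x y x0 y0; rewrite lcmn_gt0 x0. Qed.

Lemma weight_aa i : (q i * a i = d)%N.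
Proof. by rewrite mulnC divnK ?weight_dvd. Qed.

Lemma weight_le i : (q i <= d)%N.
Proof. by rewrite dvdn_leq ?weight_dvd ?dlcm_gt0. Qed.

Lemma aa_gt0 i : (0 < a i)%N.
Proof. by rewrite divn_gt0 // weight_le. Qed.

(** The third index is 0, of weight 1. *)
Lemma lcm2 i j : (0 < i)%N -> (0 < j)%N -> i != j -> lcmn (q i) (q j) = d.
Proof.
move=> i0 j0 ij; rewrite -[LHS](lcm1n) lcmnA -q0 lcm3 //; apply/eqP => e.
  by rewrite -e in i0.
by rewrite -e in j0.
Qed.

(** If [g] divides [a i] and [a j], then [q i] and [q j], hence their lcm [d], divide [d / g]. *)
Lemma coprime_aa i j : (0 < i)%N -> (0 < j)%N -> i != j -> coprime (a i) (a j).
Proof.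
move=> i0 j0 ij; rewrite /coprime; set g := gcdn _ _.
have g0 : (0 < g)%N by rewrite gcdn_gt0 aa_gt0.
have h l : (g %| a l -> q l * g %| d)%N by move=> gl; rewrite -(weight_aa l) dvdn_pmul2l.
have gd : (g %| d)%N by apply: dvdn_trans (h i (dvdn_gcdl _ _)); rewrite dvdn_mull.
have : (d %| d %/ g)%N.
  by rewrite -{1}(lcm2 i0 j0 ij) dvdn_lcm !dvdn_divRL ?h ?dvdn_gcdl ?dvdn_gcdr.
rewrite dvdn_divRL // => /dvdn_leq; rewrite dlcm_gt0 => /(_ isT).
rewrite -{2}[d]muln1 leq_pmul2l ?dlcm_gt0 // => g1.
by rewrite eqn_leq g1 g0.
Qed.

Lemma common_root x y : (forall i, (0 < i)%N -> x i ^+ a i = y i ^+ a i) ->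
  exists2 l : C, l ^+ d = 1 & forall i, (0 < i)%N -> y i = l ^+ q i * x i.
Proof.
move=> exy; have [z zP] := prim_root_exists C dlcm_gt0.
(* [z ^+ q i] is a primitive root of order [a i], so the exponent [e i] matters only modulo
   [a i]. *)
have /choice[e He] i : exists e : nat, (0 < i)%N -> y i = z ^+ (q i * e) * x i.
  have [i0|i0] := posnP i; first by exists 0%N.
  have [xi|xi] := eqVneq (x i) 0.
    exists 0%N => _; rewrite xi mulr0; apply/eqP.
    have /eqP := exy i i0; rewrite xi expr0n gtn_eqF ?aa_gt0 // eq_sym expf_eq0.
    by case/andP.
  have zi : (a i).-primitive_root (z ^+ q i).
    by have := exp_prim_root zP (q i); rewrite (gcdn_idPl (weight_dvd i)).
  have [|e E] := prim_rootP zi (x := y i / x i).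
    by rewrite expr_div_n -exy // mulfV // expf_neq0.
  by exists e => _; rewrite exprM -E divfK.
pose s := [seq i : 'I_n.+1 <- enum 'I_n.+1 | (0 < i)%N].
have sE i : (i \in s) = (0 < i)%N by rewrite mem_filter mem_enum andbT.
have [||N HN] := @chinese_remainder_seq _ a e s.
- by rewrite filter_uniq ?enum_uniq.
- by move=> i j; rewrite !sE; apply: coprime_aa.
exists (z ^+ N); first by rewrite exprAC (prim_expr_order zP) expr1n.
move=> i i0; rewrite He // -exprM; congr (_ * _); apply/eqP.
by rewrite (eq_prim_root_expr zP) -(weight_aa i) (mulnC N) -!muln_modr HN ?sE.
Qed.

Lemma wequiv_scale (l : C) x y : l != 0 ->
  wequiv q (fun i => l ^+ q i * x i) y -> wequiv q x y.
Proof.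
move=> l0 [r r0 yr]; exists (r * l) => [|i]; rewrite ?mulf_neq0 // yr.
by rewrite exprMn mulrA.
Qed.

Lemma root1_neq0 (M : nat) (l : C) : (0 < M)%N -> l ^+ M = 1 -> l != 0.
Proof.
move=> M0 l1; apply/eqP => l0; move: l1; rewrite l0 expr0n gtn_eqF // => /esym/eqP.
by rewrite oner_eq0.
Qed.

Lemma wequiv_common_root x y : x ord0 = 0 -> y ord0 = 0 ->
  (forall i, (0 < i)%N -> x i ^+ a i = y i ^+ a i) -> wequiv q x y.
Proof.
move=> x0 y0 /common_root[l l1 yl]; exists l => [|i]; first exact: root1_neq0 dlcm_gt0 l1.
have [i0|i0] := posnP i; last exact: yl.
by have -> : i = ord0 by [apply: val_inj]; rewrite x0 y0 mulr0.
Qed.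

Let ord00 : inord 0 = ord0 :> 'I_n.+1.
Proof. by apply: val_inj; rewrite /= inordK. Qed.

Lemma phi1_eval x (l : 'I_n.+2) : (phi1 R q l).@[x] =
  if (l == 0 :> nat)%N then x ord0 ^+ d
  else if (l == 1 :> nat)%N then x ord0 ^+ (d - q (inord 1)) * x (inord 1)
  else if (l == n.+1 :> nat)%N then x (inord n) ^+ a (inord n)
  else x (inord l.-1) ^+ a (inord l.-1) + x ord0 ^+ (d - q (inord l)) * x (inord l).
Proof.
by rewrite /phi1 ord00; do !case: ifP => _; rewrite ?mevalD ?mevalM ?rmorphXn /= ?mevalXU //.
Qed.

Lemma phi1_whomog l : whomog q d%:Z (phi1 R q l).
Proof.
have h j : whomog q d%:Z ('X_ord0 ^+ (d - q j) * 'X_j : {mpoly C[n.+1]}).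
  rewrite -{1}(subnK (weight_le j)) -[X in (X + _)%N]mul1n -q0.
  by apply: whomogM; [apply: whomogX|]; apply: whomogXU.
have h' j : whomog q d%:Z ('X_j ^+ a j : {mpoly C[n.+1]}).
  by rewrite -(weight_aa j); apply: whomogX; apply: whomogXU.
rewrite /phi1 ord00; do !case: ifP => _ //; last exact: whomogD.
by have := h' ord0; rewrite /aa q0 divn1.
Qed.

Lemma phi1_separating x y :
  (forall l, (phi1 R q l).@[x] = (phi1 R q l).@[y]) -> wequiv q x y.
Proof.
move=> exy.
have [x0|x0] := eqVneq (x ord0) 0.
  have y0 : y ord0 = 0.
    have := exy ord0; rewrite !phi1_eval /= x0 expr0n gtn_eqF ?dlcm_gt0 // => /esym/eqP.
    by rewrite expf_eq0 => /andP[_ /eqP].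
  apply: wequiv_common_root => //.
  (* With [x_0 = 0] the elimination runs from the last coordinate down. *)
  suff H s : forall i, (0 < i)%N -> (n <= i + s)%N -> x i ^+ a i = y i ^+ a i.
    by move=> i i0; apply: (H n) => //; apply: leq_addl.
  elim: s => [|s IH] i i0 lei.
    have in_ : i = inord n by apply: val_inj; rewrite /= inordK //; have := ltn_ord i; lia.
    have := exy ord_max; rewrite !phi1_eval /= eqxx -in_.
    by rewrite !ifF //; lia.
  have [ltin|lein] := ltnP i n; last by apply: IH => //; lia.
  have lti : (i.+1 < n.+2)%N by lia.
  have := exy (Ordinal lti); rewrite !phi1_eval /= !ifF; try lia.
  rewrite inord_val x0 y0; set j := inord i.+1.
  have ji : j = i.+1 :> nat by rewrite /j inordK //; lia.
  suff -> : 0 ^+ (d - q j) * x j = 0 ^+ (d - q j) * y j by move/addIr.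
  (* If [q j = d], then [0 ^+ 0] is 1 and the term is [x j] itself, already known because
     [a j = 1]. *)
  have [dq|dq] := posnP (d - q j); last by rewrite expr0n gtn_eqF // !mul0r.
  have qd : q j = d by have := weight_le j; lia.
  have aj : a j = 1%N by rewrite /aa qd divnn dlcm_gt0.
  have := IH j; rewrite aj !expr1 => -> //; lia.
have /eqP := exy ord0; rewrite !phi1_eval /= => /eqP e0.
(* After scaling, the coordinates of index 0 agree and are nonzero; each later coordinate then
   enters its section linearly, and the elimination runs upwards. *)
pose l := y ord0 / x ord0.
have l1 : l ^+ d = 1 by rewrite expr_div_n -e0 mulfV // expf_neq0.
have l0 : l != 0 by apply: root1_neq0 l1; apply: dlcm_gt0.
apply: (wequiv_scale l0); set x' := fun i => _.
have {}exy k : (phi1 R q k).@[x'] = (phi1 R q k).@[y].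
  by rewrite (whomog_eval _ _ (@phi1_whomog k)) l1 mul1r exy.
have x'0 : x' ord0 = y ord0 by rewrite /x' q0 expr1 divfK.
have y0 : y ord0 != 0 by rewrite -x'0 /x' mulf_neq0 // expf_neq0.
exists 1; rewrite ?oner_eq0 // => i; rewrite expr1n mul1r.
suff H s : forall i : 'I_n.+1, (i <= s)%N -> x' i = y i by rewrite (H i).
elim: s => [|s IH] {}i lei.
  by have -> : i = ord0 by [apply: val_inj; apply/eqP; rewrite -leqn0].
have [lti|gei] := ltnP i s.+1; first exact: IH.
have iE : i = s.+1 :> nat by lia.
have lt : (i < n.+2)%N by apply: ltnW; rewrite ltnS.
have i0 : (i == 0 :> nat)%N = false by lia.
have := exy (Ordinal lt); rewrite !phi1_eval /= x'0 i0.
have ltin := ltn_ord i.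
have [i1|i1] := eqVneq (i : nat) 1%N.
  have -> : inord 1 = i by apply: val_inj; rewrite /= inordK // i1.
  by move/mulfI => -> //; rewrite expf_neq0.
rewrite !ifF; try lia.
rewrite inord_val IH; last by rewrite inordK; lia.
by move/addrI/mulfI => -> //; rewrite expf_neq0.
Qed.

Theorem phi1_inj_morphism : inj_morphism q d%:Z (phi1 R q).
Proof.
exact: inj_morphism_of_separating dlcm_gt0 (@phi1_whomog) phi1_separating.
Qed.


Lemma weight_bb i j : (q i * b i j = lcmn (q i) (q j))%N.
Proof. by rewrite mulnC divnK ?dvdn_lcml. Qed.

Lemma bb_le_aa i j : (b i j <= a i)%N.
Proof. by rewrite leq_div2r // dvdn_leq ?dlcm_gt0 // dvdn_lcm !weight_dvd. Qed.

Lemma bb_diag i : b i i = 1%N.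
Proof. by rewrite /bb /lcmn gcdnn mulnK // divnn q_gt0. Qed.

Lemma bb_aa i j : (0 < i)%N -> (0 < j)%N -> i != j -> b i j = a i.
Proof. by move=> i0 j0 ij; rewrite /bb lcm2. Qed.

Section PhiK.
Variable k : nat.
Hypothesis k2 : (2 <= k)%N.

Let t i j x := x i ^+ (k * a i - b i j) * x j ^+ b j i.

Let kd_gt0 : (0 < k * d)%N.
Proof. by rewrite muln_gt0 dlcm_gt0 andbT ltnW. Qed.

Lemma phik_exponent_gt0 i j : (0 < k * a i - b i j)%N.
Proof. by rewrite subn_gt0; have := bb_le_aa i j; have := aa_gt0 i; nia. Qed.

Let t_diag i x : t i i x = x i ^+ (k * a i).
Proof. by rewrite /t bb_diag -exprD subnK // muln_gt0 aa_gt0 andbT ltnW. Qed.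

Let t_zero j x : t ord0 j x = x ord0 ^+ (k * d - q j) * x j.
Proof. by rewrite /t /bb /aa q0 lcm1n lcmn1 !divn1 divnn q_gt0 expr1. Qed.

(** Beyond index 0 the monomials depend only on the powers [x i ^+ a i], also on the diagonal, where
    [b i i] is 1 rather than [a i]. *)
Let t_pos i j x : (0 < i)%N -> (0 < j)%N -> t i j x = (x i ^+ a i) ^+ k.-1 * x j ^+ a j.
Proof.
move=> i0 j0; have [->|ij] := eqVneq i j.
  by rewrite t_diag mulnC exprM -exprSr prednK // ltnW.
have ji : j != i by rewrite eq_sym.
rewrite /t (bb_aa i0 j0 ij) (bb_aa j0 i0 ji) -exprM; congr (_ ^+ _ * _).
by case: k k2 => // k' _; rewrite mulSn addKn mulnC.
Qed.

Lemma phik_eval x l : (phik R q k l).@[x] =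
  \sum_(p : 'I_n.+1 * 'I_n.+1 | ((p.1 + p.2)%N == l) && (p.1 <= p.2)%N) t p.1 p.2 x.
Proof.
rewrite -(pair_big_dep xpredT (fun i j : 'I_n.+1 => ((i + j)%N == l) && (i <= j)%N)
  (fun i j => t i j x)) /= /phik raddf_sum; apply: eq_bigr => i _ /=.
rewrite raddf_sum; apply: eq_bigr => j _ /=.
by rewrite mevalM !rmorphXn /= !mevalXU.
Qed.

Lemma phik_whomog l : whomog q (k * d)%:Z (phik R q k l).
Proof.
apply: whomog_sum => i _; apply: whomog_sum => j _.
have -> : (k * d = q i * (k * a i - b i j) + q j * b j i)%N.
  have le := bb_le_aa i j; rewrite mulnBr !weight_bb (lcmnC (q j)) mulnCA weight_aa subnK //.
  by rewrite -weight_bb -(weight_aa i) mulnCA leq_pmul2l //; nia.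
by apply: whomogM; apply: whomogX; apply: whomogXU.
Qed.

Section Separation.
Variables x y : 'I_n.+1 -> C.
Hypothesis exy : forall l, (phik R q k l).@[x] = (phik R q k l).@[y].

(** In the section of index [c + j], monomials starting before [c] vanish, and those starting after
    [c] end before [j], where agreement is assumed. *)
Let triangular (c j : 'I_n.+1) : (c <= j)%N ->
  (forall i, (i < c)%N -> x i = 0) -> (forall i, (i < c)%N -> y i = 0) ->
  (forall i i' : 'I_n.+1, (c < i)%N -> (i <= i')%N -> (i' < j)%N -> t i i' x = t i i' y) ->
  t c j x = t c j y.
Proof.
move=> cj x0 y0 tt.
have ltl : (c + j < (n.*2).+1)%N by have := ltn_ord c; have := ltn_ord j; lia.
have := exy (Ordinal ltl); rewrite !phik_eval.
rewrite (bigD1 (c, j)) ?eqxx ?cj //= [X in _ = X -> _](bigD1 (c, j)) ?eqxx ?cj //=.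
rewrite [X in _ + X = _ -> _](eq_bigr (fun p => t p.1 p.2 y)); first by move/addIr.
move=> -[i i'] /= /andP[/andP[/eqP e le] ne].
have [lt|gt|e'] := ltngtP i c.
- by rewrite /t (x0 i lt) (y0 i lt) expr0n gtn_eqF ?phik_exponent_gt0 // !mul0r.
- by apply: tt => //; lia.
- case/negP: ne; apply/eqP; congr (_, _); first exact: val_inj.
  by apply: val_inj => /=; lia.
Qed.

Lemma phik_first_zero (c : 'I_n.+1) : (forall i, (i < c)%N -> x i = 0) ->
  forall i, (i < c)%N -> y i = 0.
Proof.
move=> x0; suff H s : forall i, (i < c)%N -> (i < s)%N -> y i = 0 by move=> i ic; apply: (H i.+1).
elim: s => // s IH i ic lis; have [lt|ge] := ltnP i s; first exact: IH.
have : t i i x = t i i y.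
  apply: triangular => // [j ji|j ji|i1 i2]; [apply: x0|apply: IH|]; lia.
rewrite !t_diag x0 // expr0n gtn_eqF ?muln_gt0 ?aa_gt0 ?andbT ?(ltnW k2) // => /esym/eqP.
by rewrite expf_eq0 => /andP[_ /eqP].
Qed.

Lemma phik_diag (c : 'I_n.+1) : (forall i, (i < c)%N -> x i = 0) ->
  x c ^+ (k * a c) = y c ^+ (k * a c).
Proof.
move=> x0; rewrite -!t_diag; apply: triangular => //; first exact: phik_first_zero.
by move=> i i' ? ? ?; lia.
Qed.

Lemma phik_determined0 : x ord0 = y ord0 -> x ord0 != 0 -> forall i, x i = y i.
Proof.
move=> e0 x0; suff H s : forall i, (i < s)%N -> x i = y i by move=> i; apply: (H i.+1).
elim: s => // s IH i lis; have : t ord0 i x = t ord0 i y.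
  by apply: triangular => // i1 i2 l1 l2 l3; rewrite /t !IH //; lia.
by rewrite !t_zero e0 => /mulfI -> //; rewrite expf_neq0 // -e0.
Qed.

Lemma phik_determined (c : 'I_n.+1) : (0 < c)%N -> (forall i, (i < c)%N -> x i = 0) ->
  x c != 0 -> x c ^+ a c = y c ^+ a c -> forall i, x i ^+ a i = y i ^+ a i.
Proof.
move=> c0 x0 xc ec.
suff H s : forall i, (i < s)%N -> x i ^+ a i = y i ^+ a i by move=> i; apply: (H i.+1).
elim: s => // s IH i lis; have [lt|ge] := ltnP i c.
  by rewrite x0 // (phik_first_zero x0).
have : t c i x = t c i y.
  apply: triangular => // [|i1 i2 l1 l2 l3]; first exact: phik_first_zero.
  by rewrite !t_pos ?IH //; lia.
by rewrite !t_pos // -?ec ?(leq_trans c0) // => /mulfI; apply; rewrite !expf_neq0.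
Qed.

End Separation.

Lemma phik_separating x y :
  (forall l, (phik R q k l).@[x] = (phik R q k l).@[y]) -> wequiv q x y.
Proof.
move=> exy.
have scale (l : C) : l ^+ (k * d) = 1 ->
    forall m, (phik R q k m).@[fun i => l ^+ q i * x i] = (phik R q k m).@[y].
  by move=> l1 m; rewrite (whomog_eval _ _ (@phik_whomog m)) l1 mul1r exy.
have [[c xc]|nx] := pselect (exists c, x c != 0); last first.
  have x0 i : x i = 0 by apply: contrapT => /eqP xi; apply: nx; exists i.
  exists 1; rewrite ?oner_eq0 // => i; rewrite x0 mulr0.
  have := phik_diag exy (fun j (_ : (j < i)%N) => x0 j).
  rewrite x0 expr0n gtn_eqF ?muln_gt0 ?aa_gt0 ?andbT ?(ltnW k2) // => /esym/eqP.
  by rewrite expf_eq0 => /andP[_ /eqP].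
case: (arg_minnP (P := fun c : 'I_n.+1 => x c != 0) (fun c => c : nat) xc) => {xc}c xc minc.
have x0 i : (i < c)%N -> x i = 0.
  by move=> ic; apply: contrapT => /eqP /minc; rewrite leqNgt ic.
have ec := phik_diag exy x0.
have [c0|c0] := posnP c.
  have {}c0 : c = ord0 by apply: val_inj.
  rewrite c0 in xc ec; move: ec; rewrite /aa q0 divn1 => ec.
  pose l := y ord0 / x ord0.
  have l1 : l ^+ (k * d) = 1 by rewrite expr_div_n -ec mulfV // expf_neq0.
  have l0 := root1_neq0 kd_gt0 l1.
  apply: (wequiv_scale l0); exists 1; rewrite ?oner_eq0 // => i; rewrite expr1n mul1r.
  apply/esym; apply: phik_determined0 (scale l l1) _ _ i; first by rewrite q0 expr1 divfK.
  by rewrite mulf_neq0 // expf_neq0.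
(* Acting by [l] multiplies [x c ^+ a c] by [l ^+ d], hence the [d]-th root; the diagonal section
   gives [l ^+ (k * d) = 1]. *)
pose w := (y c / x c) ^+ a c; pose l := d.-root w.
have ld : l ^+ d = w by apply: rootCK; apply: dlcm_gt0.
have l1 : l ^+ (k * d) = 1.
  by rewrite mulnC exprM ld /w -exprM mulnC expr_div_n -ec mulfV // expf_neq0.
have l0 := root1_neq0 kd_gt0 l1.
apply: (wequiv_scale l0).
have x0' i : (i < c)%N -> l ^+ q i * x i = 0 by move=> ic; rewrite x0 // mulr0.
apply: wequiv_common_root.
- by rewrite x0'.
- exact: (phik_first_zero exy x0).
- move=> i _; apply: (phik_determined (scale l l1) c0 x0').
    by rewrite mulf_neq0 // expf_neq0.
  by rewrite exprMn -exprM weight_aa ld /w expr_div_n divfK // expf_neq0.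
Qed.

Theorem phik_inj_morphism : inj_morphism q (k * d)%:Z (phik R q k).
Proof.
exact: inj_morphism_of_separating kd_gt0 (@phik_whomog) phik_separating.
Qed.

End PhiK.

End Embeddings.

(** * The injection dimension *)

Section InjectionDimension.
Variables (R : realType) (n : nat) (q : 'I_n.+1 -> nat).
Local Notation C := (R[i]).
Hypothesis n_gt0 : (1 <= n)%N.
Hypothesis q_gt0 : forall i, (0 < q i)%N.
Hypothesis q0 : q ord0 = 1%N.

(** In degree at most 0 all sections are constant, while the first and last coordinate points differ
    because [1 <= n]. *)
Lemma injdim_nonpos (M : int) : M <= 0 -> injdim R q M = None.
Proof.
move=> M0; rewrite /injdim; case: pselect => // h; exfalso.
case: h => N [f [_ [hom nz inj]]].
have fE j x : (f j).@[x] = \sum_(mo <- msupp (f j)) (f j)@_mo.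
  rewrite mevalE; apply: eq_big_seq => mo /(hom j) e.
  have /eqP : wdeg q mo = 0%N by apply/eqP; rewrite -leqn0 -lez_nat e.
  rewrite /wdeg sum_nat_eq0 => /forallP h; rewrite big1 ?mulr1 // => i _.
  by have := h i; rewrite /= muln_eq0 gtn_eqF //= => /eqP ->.
pose e (j i : 'I_n.+1) : C := (i == j)%:R.
have ne j : nonzero_pt (e j) by exists j; rewrite /e eqxx oner_eq0.
have [|l l0 /(_ ord0)/eqP] := inj (e ord0) (e ord_max) (ne _) (ne _).
  by exists 1 => [|j]; rewrite ?oner_eq0 // mul1r !fE.
have ne0 : ((ord0 : 'I_n.+1) == ord_max) = false.
  by rewrite -val_eqE /= eq_sym; apply: gtn_eqF.
by rewrite /e eqxx ne0 mulr1 eq_sym expf_eq0 (negbTE l0) andbF.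
Qed.

Lemma equal_weights (j : 'I_n.+1) : (0 < j)%N ->
  (forall i : 'I_n.+1, (0 < i)%N -> q i = q j) -> q j = dlcm q.
Proof.
move=> j0 eq_q; apply/eqP; rewrite eqn_dvd weight_dvd //=.
by apply/dvdn_biglcmP => i i0; rewrite eq_q.
Qed.

(** For weights [1, d, ..., d] these sections identify the weighted space with ordinary projective
    space. *)
Definition coordinate_sections (j : 'I_n.+1) : {mpoly C[n.+1]} :=
  if j == ord0 then 'X_ord0 ^+ dlcm q else 'X_j.

Lemma coordinate_inj_morphism : (forall i : 'I_n.+1, (0 < i)%N -> q i = dlcm q) ->
  inj_morphism q (dlcm q)%:Z coordinate_sections.
Proof.
move=> eq_q; have pos (j : 'I_n.+1) : j != ord0 -> (0 < j)%N by rewrite -val_eqE /= lt0n.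
apply: inj_morphism_of_separating => [|j|x y exy]; first exact: dlcm_gt0.
  rewrite /coordinate_sections; case: eqP => [_|/eqP j0].
    by rewrite -{1}[dlcm q]mul1n -q0; apply: whomogX; apply: whomogXU.
  by rewrite -(eq_q j (pos j j0)); apply: whomogXU.
have ej j : j != ord0 -> x j = y j.
  by move=> j0; have := exy j; rewrite /coordinate_sections (negbTE j0) !mevalXU.
have := exy ord0; rewrite /coordinate_sections eqxx !rmorphXn /= !mevalXU => e0.
have d0 : (0 < dlcm q)%N by apply: dlcm_gt0.
have [x0|x0] := eqVneq (x ord0) 0.
  have y0 : y ord0 = 0.
    move/esym/eqP: e0; rewrite x0 expr0n gtn_eqF // expf_eq0.
    by case/andP => _ /eqP.
  exists 1; rewrite ?oner_eq0 // => j; rewrite expr1n mul1r.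
  by have [->|/ej] := eqVneq j ord0; rewrite ?x0 ?y0.
have l1 : (y ord0 / x ord0) ^+ dlcm q = 1 by rewrite expr_div_n -e0 mulfV // expf_neq0.
exists (y ord0 / x ord0); first exact: root1_neq0 d0 l1.
move=> j; have [->|j0] := eqVneq j ord0; first by rewrite q0 expr1 divfK.
by rewrite (eq_q j (pos j j0)) l1 mul1r ej.
Qed.

End InjectionDimension.

Theorem theorem4p5 (R : realType) (n : nat) (q : 'I_n.+1 -> nat) :
  (1 <= n)%N ->
  (forall i, (0 < q i)%N) ->
  q ord0 = 1%N ->
  (forall i j k : 'I_n.+1, i != j -> j != k -> i != k ->
     lcmn (lcmn (q i) (q j)) (q k) = dlcm q) ->
  [/\ inj_morphism q (dlcm q)%:Z (phi1 R q),
      (forall k : nat, (2 <= k)%N ->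
         inj_morphism q (k * dlcm q)%:Z (phik R q k) ) &
      forall k : int,
        injdim R q (k * (dlcm q)%:Z) =
          if k <= 0 then None
          else if k == 1 then
            (if [forall i : 'I_n.+1, forall j : 'I_n.+1,
                   ((0 < i)%N && (0 < j)%N) ==> (q i == q j)]
             then Some n else Some n.+1)
          else Some (n.*2)].
Proof.
move=> n_gt0 q_gt0 q0 lcm3; have d0 : (0 < dlcm q)%N by apply: dlcm_gt0.
have h1 := phi1_inj_morphism R n_gt0 q_gt0 q0 lcm3.
have hk := fun k => @phik_inj_morphism R n q n_gt0 q_gt0 q0 lcm3 k.
split=> // k; case: ifP => [k0|/negbT]; first by apply: injdim_nonpos => //; nia.
rewrite -ltNge => k0; have [m kE] : exists m : nat, k = m.+1%:Z.
  by case: k k0 => [[|m]|] // _; exists m.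
rewrite kE; case: eqP => [[->]|m1].
  rewrite mul1r; case: ifP => [/'forall_'forall_implyP eq_q|/negbT neq_q].
    apply: (injdim_eq (f := coordinate_sections R q)) => [|N g hg].
      apply: coordinate_inj_morphism => // i i0; apply: equal_weights => // j j0.
      by apply/eqP; apply: eq_q; rewrite j0.
    exact: sections_dim_bound q0 d0 hg.
  have [i [i0 qi]] : exists i : 'I_n.+1, (0 < i)%N /\ q i != dlcm q.
    apply: contrapT => h; case/negP: neq_q; apply/'forall_'forall_implyP => i j /andP[i0 j0].
    have eqd (l : 'I_n.+1) : (0 < l)%N -> q l = dlcm q.
      by move=> l0; apply: contrapT => /eqP ql; apply: h; exists l.
    by rewrite !eqd.
  (* A weight [q i != d] allows [del = q i], [kap = aa q i >= 2] and [T = {0, i}], whence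
     [N >= n + 1]. *)
  apply: (injdim_eq h1) => N g hg.
  have dE : (dlcm q = q i * aa q i)%N by rewrite weight_aa.
  have i_0 : ord0 != i by rewrite -val_eqE /= eq_sym -lt0n.
  have a1 : (1 < aa q i)%N.
    by move: qi d0; rewrite {1 2}dE; case: (aa q i) => [|[|]] //; rewrite ?muln0 ?muln1 ?eqxx.
  have := @sections_lower_bound R n q q_gt0 [set ord0; i] (q i) (aa q i) N g q0.
  rewrite cards2 i_0 -dE !inE eqxx => /(_ isT) h.
  have : (n + 2 <= N.+1)%N.
    by apply: h => // j; rewrite !inE => /orP[/eqP ->|/eqP -> //]; rewrite q0.
  by lia.
have m2 : (2 <= m.+1)%N by case: m m1 {kE} => // -[].
rewrite -PoszM; apply: (injdim_eq (hk _ m2)) => N g hg.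
(* All weights divide [d], so [T] can be everything, with [del = d] and [kap = k]; this gives
   [N.+1 >= 2n + 1]. *)
have := @sections_lower_bound R n q q_gt0 setT (dlcm q) m.+1 N g q0.
rewrite mulnC => h; have : (n + #|[set: 'I_n.+1]| <= N.+1)%N.
  by apply: h => [|j _|||] //; rewrite ?inE ?weight_dvd.
by rewrite cardsT card_ord; lia.
Qed.
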